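(* For every $\varepsilon>0$ and $\delta>0$ there exist states $\rho_0,\rho_1$ on a finite-dimensional bipartite system $AB$ with $P_{\mathrm{opt}}(\rho_0,\rho_1)=1$ (i.e. $\rho_0$ and $\rho_1$ are orthogonal) such that $$P_{\mathrm{LOCC}}(\rho_0,\rho_1)<\tfrac12+\varepsilon\quad\text{and}\quad R_{\mathrm m}(\rho_0,\rho_1)>1-\delta.$$
   Context: All systems are finite-dimensional. $P_{\mathrm{opt}}(\rho_0,\rho_1)=\tfrac12+\tfrac14\|\rho_0-\rho_1\|_1$. LOCC denotes local operations and classical communication between Alice (systems $A,A'$) and Bob (systems $B,B'$). An LOCC measurement channel is $\mathcal M(X)=\sum_i\mathrm{Tr}[M_iX]|ii\rangle\langle ii|$ with $\{M_i\}$ an LOCC-implementable POVM; $\|X\|_{\mathrm{LOCC}}=\sup_{\mathcal M}\|\mathcal M(X)\|_1$; $P_{\mathrm{LOCC}}(\rho_0,\rho_1)=\tfrac12+\tfrac14\|\rho_0-\rho_1\|_{\mathrm{LOCC}}$. Repeated discrimination framework: $Z_j$ i.i.d. uniform on $\{0,1\}$; in round $j$ the state $\rho_{Z_j}$ is given, the guess is $Y_j$, $X_j=1$ iff $Y_j=Z_j$, $S_n=\sum_{j\le n}X_j$. A rate $r$ is achievable if for all $\varepsilon>0$, $m>0$ there is $n\ge m$ with $\Pr(S_n\ge rn)\ge1-\varepsilon$. Memory-assisted protocols: a finite-dimensional shared memory $A'B'$ with initial state $\mu_1^{A'B'}$; in round $j$ an LOCC protocol (allowed to depend on all classical outcomes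 of earlier rounds, but not on the $Z$'s) is applied to $\rho^{AB}_{Z_j}\otimes\mu_j^{A'B'}$, producing $Y_j$ and an outcome-dependent memory state $\mu_{j+1}^{A'B'}$ passed to the next round. $R_{\mathrm m}(\rho_0,\rho_1)$ is the supremum of achievable rates over all memory dimensions, initial memory states and such protocols. *)

(* Defs.v *)
(* mathcomp + real_closed (complex numbers R[i], tensor
   products of matrices) + mathcomp-analysis reals (supremum). *)
From HB Require Import structures.
From mathcomp Require Import all_boot all_order all_algebra.
From mathcomp Require Import complex mxtens.
From mathcomp Require Import classical_sets reals.

Set Implicit Arguments.
Unset Strict Implicit.
Unset Printing Implicit Defensive.

Import Order.TTheory GRing.Theory Num.Theory.
Local Open Scope ring_scope.

Section Quantum.
Variable R : realType.
Local Notation C := R[i].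

(* conjugate transpose *)
Definition adj m n (A : 'M[C]_(m, n)) : 'M[C]_(n, m) :=
  (map_mx (fun z => z^*) A)^T.

(* positive semidefinite (over C this also forces hermiticity) *)
Definition psd n (A : 'M[C]_n) : Prop :=
  forall v : 'cV[C]_n, 0 <= (adj v *m A *m v) 0 0.

(* density operator (quantum state) *)
Definition is_state n (rho : 'M[C]_n) : Prop := psd rho /\ \tr rho = 1.

Definition unitary n (U : 'M[C]_n) : Prop := adj U *m U = 1%:M.

(* trace norm, ||X||_1 = max_{U unitary} Re Tr(U X) *)
Definition trnorm n (X : 'M[C]_n) : R :=
  sup [set t : R | exists U : 'M[C]_n, unitary U /\ t = complex.Re (\tr (U *m X))].

Definition P_opt n (rho0 rho1 : 'M[C]_n) : R :=
  2^-1 + 4^-1 * trnorm (rho0 - rho1).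

(* Finite-round LOCC protocols.  A protocol on a bipartite system whose *)
(* current local dimensions are a (Alice) and b (Bob) is a finite tree: *)
(* at each node one party applies a local instrument given by Kraus     *)
(* operators (possibly changing its local dimension, e.g. adding        *)
(* ancillas), the outcome is broadcast and selects the subtree.  A leaf *)
(* carries the classical output label (in O) and the remaining quantum  *)
(* system, whose local dimensions are fixed to (aF, bF).                *)
(* Joint systems use the ordering Alice (x) Bob, i.e. 'M_(a * b), with  *)
(* the Kronecker product tensmx of mxtens.                              *)
Inductive proto (O : Type) (aF bF : nat) : nat -> nat -> Type :=
| PLeaf : O -> proto O aF bF aF bF
| PAlice a b (k : nat) (a' : 'I_k -> nat) (K : forall i : 'I_k, 'M[C]_(a' i, a))
    (next : forall i : 'I_k, proto O aF bF (a' i) b) : proto O aF bF a b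
| PBob a b (k : nat) (b' : 'I_k -> nat) (L : forall i : 'I_k, 'M[C]_(b' i, b))
    (next : forall i : 'I_k, proto O aF bF a (b' i)) : proto O aF bF a b.

Section Proto.
Variables (O : eqType) (aF bF : nat).

(* every local instrument is trace preserving *)
Fixpoint proto_wf a b (p : proto O aF bF a b) : Prop :=
  match p with
  | PLeaf _ => True
  | PAlice a b k a' K next =>
      (\sum_(i < k) adj (K i) *m K i = 1%:M) /\ forall i, proto_wf (next i)
  | PBob a b k b' L next =>
      (\sum_(i < k) adj (L i) *m L i = 1%:M) /\ forall i, proto_wf (next i)
  end.

(* the list of (classical label, joint Kraus operator) of all leaves *)
Fixpoint kraus a b (p : proto O aF bF a b) : seq (O * 'M[C]_(aF * bF, a * b)) :=
  match p in proto _ _ _ a b return seq (O * 'M[C]_(aF * bF, a * b)) with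
  | PLeaf o => [:: (o, 1%:M)]
  | PAlice a b k a' K next =>
      flatten [seq [seq (x.1, x.2 *m (K i *t (1%:M : 'M[C]_b))) | x <- kraus (next i)]
              | i <- enum 'I_k]
  | PBob a b k b' L next =>
      flatten [seq [seq (x.1, x.2 *m ((1%:M : 'M[C]_a) *t L i)) | x <- kraus (next i)]
              | i <- enum 'I_k]
  end.

(* the classical outcomes that can occur *)
Definition labels a b (p : proto O aF bF a b) : seq O := undup (map fst (kraus p)).

(* POVM element of outcome o *)
Definition povm a b (p : proto O aF bF a b) (o : O) : 'M[C]_(a * b) :=
  \sum_(x <- kraus p | x.1 == o) adj x.2 *m x.2.

(* (unnormalised) post-measurement state on the output system, outcome o *)
Definition chan_out a b (p : proto O aF bF a b) (o : O) (X : 'M[C]_(a * b))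
  : 'M[C]_(aF * bF) :=
  \sum_(x <- kraus p | x.1 == o) x.2 *m X *m adj x.2.
End Proto.

(* LOCC measurements: LOCC protocols with trivial final quantum system. *)
(* ||M(X)||_1 for M(X) = sum_i Tr[M_i X] |ii><ii| equals sum_i |Tr[M_i X]|. *)
Definition locc_norm dA dB (X : 'M[C]_(dA * dB)) : R :=
  sup [set t : R | exists p : proto nat 1 1 dA dB, proto_wf p /\
         t = \sum_(o <- labels p) complex.Re `|\tr (povm p o *m X)| ].

Definition P_LOCC dA dB (rho0 rho1 : 'M[C]_(dA * dB)) : R :=
  2^-1 + 4^-1 * locc_norm (rho0 - rho1).

(* Memory-assisted repeated discrimination.                             *)
(* reorder (A B) (A' B') into (A A') (B B') *)
Definition reord_idx dA dB mA mB (c : 'I_((dA * dB) * (mA * mB))) : 'I_((dA * mA) * (dB * mB)) :=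
  let ab := (mxtens_unindex c).1 in let ab' := (mxtens_unindex c).2 in
  let a := (mxtens_unindex ab).1 in let b := (mxtens_unindex ab).2 in
  let a' := (mxtens_unindex ab').1 in let b' := (mxtens_unindex ab').2 in
  mxtens_index (mxtens_index (a, a'), mxtens_index (b, b')).

Definition reord dA dB mA mB : 'M[C]_((dA * mA) * (dB * mB), (dA * dB) * (mA * mB)) :=
  \matrix_(r, c) (if r == reord_idx c then 1 else 0).

(* the state rho^{AB} (x) mu^{A'B'} viewed on (A A') (B B') *)
Definition joint dA dB mA mB (rho : 'M[C]_(dA * dB)) (mu : 'M[C]_(mA * mB))
  : 'M[C]_((dA * mA) * (dB * mB)) :=
  reord dA dB mA mB *m (rho *t mu) *m (reord dA dB mA mB)^T.

(* round outcome: (guess Y_j, further classical data) *)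
Definition outc := (bool * nat)%type.

Section Memory.
Variables (dA dB : nat) (rho0 rho1 : 'M[C]_(dA * dB)).
Variables (mA mB : nat) (mu1 : 'M[C]_(mA * mB)).
(* the LOCC protocol of each round, as a function of the classical *)
(* outcomes of all earlier rounds (and not of the Z's)              *)
Variable strat : seq outc -> proto outc mA mB (dA * mA) (dB * mB).

Definition rho_of (z : bool) := if z then rho1 else rho0.

(* all histories of n rounds: the list of (Z_j, outcome_j), together with *)
(* the unnormalised memory state, whose trace is the probability of the   *)
(* history (each Z_j uniform and independent).                           *)
Fixpoint runs (n : nat) : seq (seq (bool * outc) * 'M[C]_(mA * mB)) :=
  match n with
  | 0 => [:: ([::], mu1)]
  | n'.+1 =>
      flatten [seq flatten [seq
        [seq (rcons h.1 (z, o),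
              2^-1 *: chan_out (strat (map snd h.1)) o (joint (rho_of z) h.2))
        | o <- labels (strat (map snd h.1))]
        | z <- [:: false; true]] | h <- runs n']
  end.

(* S_n = number of rounds with Y_j = Z_j *)
Definition successes (h : seq (bool * outc)) : nat :=
  count (fun zo : bool * outc => zo.2.1 == zo.1) h.

(* Pr(S_n >= r n) *)
Definition prob_Sn_ge (n : nat) (r : R) : R :=
  \sum_(h <- runs n | r * n%:R <= (successes h.1)%:R) complex.Re (\tr h.2).

Definition achievable (r : R) : Prop :=
  forall eps : R, 0 < eps -> forall m : nat, (0 < m)%N ->
    exists n : nat, (m <= n)%N /\ 1 - eps <= prob_Sn_ge n r.
End Memory.

Definition R_m dA dB (rho0 rho1 : 'M[C]_(dA * dB)) : R :=
  sup [set r : R | exists (mA mB : nat) (mu1 : 'M[C]_(mA * mB))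
         (strat : seq outc -> proto outc mA mB (dA * mA) (dB * mB)),
         is_state mu1 /\ (forall h, proto_wf (strat h)) /\
         achievable rho0 rho1 mu1 strat r].

End Quantum.

(* Main.v *)
(* With probability [1 - p] the state is a data-hiding one: the symmetric or the
   antisymmetric state over the pairs [x != y] of basis vectors in dimension [d].
   With probability [p] it carries a public flag, the bit [z] in the clear and a
   maximally entangled state of rank [d ^ m].
   - A local observer sees [z] only if the flag is raised: the difference of the
     hiding states is a multiple of the swap restricted to [x != y], and the
     partially transposed swap is positive, so that every separable measurement
     has bias [O(1/d)] on it.
   - With a maximally entangled pair of rank [d] the hiding states are told apart
     by teleportation.  Keeping a memory of up to [m] such pairs, refilled at
     every flagged round, the parties err only while the memory is empty.
   - The memory level is a Markov chain on which [1 + (1 - p) ^ c], multiplied by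
     a constant [t > 1] per error, grows in mean by a factor at most
     [1 + p * (1 - p) ^ m] per round; Markov's inequality then makes the error
     frequency exceed [1 / K] with exponentially small probability. *)

Require Import Defs.
From HB Require Import structures.
From mathcomp Require Import all_boot all_order all_algebra.
From mathcomp Require Import complex mxtens.
From mathcomp Require Import classical_sets reals ring lra.
Set Implicit Arguments.
Unset Strict Implicit.
Unset Printing Implicit Defensive.
Import Order.TTheory GRing.Theory Num.Theory.
Local Open Scope ring_scope.

(** * Bipartite vectors as matrices *)

Section Vectorization.
Variable R : realType.
Local Notation C := R[i].

Lemma adj_entry m n (A : 'M[C]_(m, n)) i j : adj A i j = (A j i)^*.
Proof. by rewrite !mxE. Qed.

Lemma adj_mul m n p (A : 'M[C]_(m, n)) (B : 'M_(n, p)) :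
  adj (A *m B) = adj B *m adj A.
Proof.
apply/matrixP=> i j; rewrite adj_entry !mxE rmorph_sum; apply: eq_bigr => k _.
by rewrite !adj_entry rmorphM mulrC.
Qed.

Lemma adj_invol m n (A : 'M[C]_(m, n)) : adj (adj A) = A.
Proof. by apply/matrixP=> i j; rewrite !adj_entry conjCK. Qed.

Lemma adj_id n : adj (1%:M : 'M[C]_n) = 1%:M.
Proof. by apply/matrixP=> i j; rewrite adj_entry !mxE rmorph_nat eq_sym. Qed.

Lemma adj_add m n (A B : 'M[C]_(m, n)) : adj (A + B) = adj A + adj B.
Proof. by apply/matrixP=> i j; rewrite !mxE rmorphD. Qed.

Lemma adj_scale m n (c : C) (A : 'M[C]_(m, n)) : adj (c *: A) = c^* *: adj A.
Proof. by apply/matrixP=> i j; rewrite !mxE rmorphM. Qed.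

Lemma adj_tens m n p q (A : 'M[C]_(m, n)) (B : 'M_(p, q)) :
  adj (A *t B) = adj A *t adj B.
Proof. by apply/matrixP=> i j; rewrite !mxE rmorphM. Qed.

Lemma tr_adj n (A : 'M[C]_n) : \tr (adj A) = (\tr A)^*.
Proof. by rewrite /mxtrace rmorph_sum; apply: eq_bigr => i _; apply: adj_entry. Qed.

Lemma sum_tens (V : nmodType) m n (f : 'I_(m * n) -> V) :
  \sum_k f k = \sum_i \sum_j f (mxtens_index (i, j)).
Proof.
rewrite pair_big (reindex (fun ij : 'I_m * 'I_n => mxtens_index ij)) /=.
  by apply: eq_bigr => -[].
by exists (@mxtens_unindex m n) => i _; rewrite (mxtens_indexK, mxtens_unindexK).
Qed.

Lemma mxtens_eq m n (i k : 'I_m) (j l : 'I_n) :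
  (mxtens_index (i, j) == mxtens_index (k, l)) = (i == k) && (j == l).
Proof. by rewrite (can_eq (@mxtens_indexK m n)). Qed.

(* A bipartite vector is the matrix [Psi] of its coefficients, rows indexed by
   Alice; [K *t L] then acts by [Psi |-> K *m Psi *m L^T]. *)
Definition cvec a b (Psi : 'M[C]_(a, b)) : 'cV[C]_(a * b) :=
  \col_k Psi (mxtens_unindex k).1 (mxtens_unindex k).2.

Definition vproj a b (Psi : 'M[C]_(a, b)) : 'M[C]_(a * b) :=
  cvec Psi *m adj (cvec Psi).

Lemma cvecE a b (Psi : 'M[C]_(a, b)) i j l :
  cvec Psi (mxtens_index (i, j)) l = Psi i j.
Proof. by rewrite mxE mxtens_indexK. Qed.

Lemma vprojE a b (Psi : 'M[C]_(a, b)) i j k l :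
  vproj Psi (mxtens_index (i, j)) (mxtens_index (k, l)) = Psi i j * (Psi k l)^*.
Proof. by rewrite mxE big_ord1 adj_entry !cvecE. Qed.

Lemma tens_cvec a b a' b' (K : 'M[C]_(a', a)) (L : 'M_(b', b)) Psi :
  (K *t L) *m cvec Psi = cvec (K *m Psi *m L^T).
Proof.
apply/matrixP=> k l; case: (mxtens_indexP k) => i j.
rewrite cvecE !mxE sum_tens exchange_big /=; apply: eq_bigr => y _.
rewrite !mxE big_distrl /=; apply: eq_bigr => x _.
by rewrite tensmxE cvecE mulrAC.
Qed.

Lemma tens_vproj a b a' b' (K : 'M[C]_(a', a)) (L : 'M_(b', b)) Psi :
  (K *t L) *m vproj Psi *m adj (K *t L) = vproj (K *m Psi *m L^T).
Proof. by rewrite /vproj -tens_cvec adj_mul !mulmxA. Qed.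

Lemma vprojZ a b (c : C) (Psi : 'M[C]_(a, b)) :
  vproj (c *: Psi) = (`|c| ^+ 2) *: vproj Psi.
Proof.
apply/matrixP=> k l; case: (mxtens_indexP k) => i j.
case: (mxtens_indexP l) => i' j'.
by rewrite [RHS]mxE !vprojE !mxE rmorphM normCK mulrACA.
Qed.

Lemma tr_vproj a b (Psi : 'M[C]_(a, b)) :
  \tr (vproj Psi) = \sum_i \sum_j `|Psi i j| ^+ 2.
Proof.
rewrite /mxtrace sum_tens; apply: eq_bigr => i _; apply: eq_bigr => j _.
by rewrite vprojE normCK.
Qed.

Lemma psd_vproj a b (Psi : 'M[C]_(a, b)) : psd (vproj Psi).
Proof.
move=> v; rewrite /vproj mulmxA -mulmxA -[X in _ *m (_ *m X)]adj_invol -adj_mul.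
by rewrite mxE big_ord1 adj_entry -normCK exprn_ge0.
Qed.

Lemma psdD n (A B : 'M[C]_n) : psd A -> psd B -> psd (A + B).
Proof. by move=> pA pB v; rewrite mulmxDr mulmxDl mxE addr_ge0. Qed.

Lemma psdZ n (c : C) (A : 'M[C]_n) : 0 <= c -> psd A -> psd (c *: A).
Proof. by move=> c0 pA v; rewrite -scalemxAr -scalemxAl mxE mulr_ge0. Qed.

Lemma psd0 n : psd (0 : 'M[C]_n).
Proof. by move=> v; rewrite mulmx0 mul0mx mxE. Qed.

Lemma psd_sum n (I : Type) (r : seq I) (P : pred I) (F : I -> 'M[C]_n) :
  (forall i, P i -> psd (F i)) -> psd (\sum_(i <- r | P i) F i).
Proof. by move=> pF; apply: big_ind => //; [apply: psd0 | apply: psdD]. Qed.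

Lemma psd_conj m n (K : 'M[C]_(m, n)) A : psd A -> psd (K *m A *m adj K).
Proof.
move=> pA v; have := pA (adj K *m v); rewrite adj_mul adj_invol.
by rewrite !mulmxA.
Qed.

Lemma psd_tr n (A : 'M[C]_n) : psd A -> 0 <= \tr A.
Proof.
move=> pA; apply: sumr_ge0 => i _; have := pA (delta_mx i 0).
have -> : adj (delta_mx i 0 : 'cV[C]_n) = delta_mx 0 i.
  apply/matrixP=> k l; rewrite adj_entry !mxE rmorph_nat.
  by rewrite andbC.
by rewrite -rowE -colE !mxE.
Qed.

(** All later facts about [joint] rest on this formula, the one place where the permutation matrix
    [reord] is unfolded. *)
Lemma jointE dA dB mA mB (rho : 'M[C]_(dA * dB)) (mu : 'M[C]_(mA * mB))
    a a' b b' k k' l l' :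
  joint rho mu (mxtens_index (mxtens_index (a, k), mxtens_index (b, l)))
    (mxtens_index (mxtens_index (a', k'), mxtens_index (b', l'))) =
  rho (mxtens_index (a, b)) (mxtens_index (a', b'))
  * mu (mxtens_index (k, l)) (mxtens_index (k', l')).
Proof.
have reordE (x : 'I_dA) (u : 'I_mA) (y : 'I_dB) (v : 'I_mB) c :
  (mxtens_index (mxtens_index (x, u), mxtens_index (y, v)) == reord_idx c)
  = (c == mxtens_index (mxtens_index (x, y), mxtens_index (u, v))).
  case: (mxtens_indexP c) => ab uv; case: (mxtens_indexP ab) => {ab} x' y'.
  case: (mxtens_indexP uv) => {uv} u' v'.
  rewrite /reord_idx !mxtens_indexK /= !mxtens_eq.
  rewrite (eq_sym x) (eq_sym u) (eq_sym y) (eq_sym v).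
  by rewrite -!andbA; congr (_ && _); rewrite andbCA.
rewrite /joint mxE (bigD1 (mxtens_index (mxtens_index (a', b'), mxtens_index (k', l')))) //=.
rewrite big1 ?addr0 => [|c /negPf neq]; last first.
  by rewrite !mxE reordE neq mulr0.
rewrite !mxE reordE eqxx mulr1.
rewrite (bigD1 (mxtens_index (mxtens_index (a, b), mxtens_index (k, l)))) //=.
rewrite big1 ?addr0 => [|c /negPf neq]; last first.
  by rewrite !mxE reordE neq mul0r.
by rewrite !mxE reordE eqxx mul1r !mxtens_indexK.
Qed.

(** Regrouping the systems becomes the Kronecker product of coefficient matrices, so that a round on
    pure states is computed by matrix products. *)
Lemma joint_vproj dA dB mA mB (Psi : 'M[C]_(dA, dB)) (M : 'M[C]_(mA, mB)) :
  joint (vproj Psi) (vproj M) = vproj (Psi *t M).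
Proof.
apply/matrixP=> k l.
case: (mxtens_indexP k) => x y; case: (mxtens_indexP l) => x' y'.
case: (mxtens_indexP x) => a1 a2; case: (mxtens_indexP y) => b1 b2.
case: (mxtens_indexP x') => a1' a2'; case: (mxtens_indexP y') => b1' b2'.
by rewrite jointE !vprojE !tensmxE rmorphM mulrACA.
Qed.

Lemma jointDl dA dB mA mB (r1 r2 : 'M[C]_(dA * dB)) (mu : 'M[C]_(mA * mB)) :
  joint (r1 + r2) mu = joint r1 mu + joint r2 mu.
Proof.
apply/matrixP=> k l.
case: (mxtens_indexP k) => x y; case: (mxtens_indexP l) => x' y'.
case: (mxtens_indexP x) => a1 a2; case: (mxtens_indexP y) => b1 b2.
case: (mxtens_indexP x') => a1' a2'; case: (mxtens_indexP y') => b1' b2'.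
by rewrite [RHS]mxE !jointE !mxE mulrDl.
Qed.

Lemma jointZl dA dB mA mB (c : C) (rho : 'M[C]_(dA * dB)) (mu : 'M[C]_(mA * mB)) :
  joint (c *: rho) mu = c *: joint rho mu.
Proof.
apply/matrixP=> k l.
case: (mxtens_indexP k) => x y; case: (mxtens_indexP l) => x' y'.
case: (mxtens_indexP x) => a1 a2; case: (mxtens_indexP y) => b1 b2.
case: (mxtens_indexP x') => a1' a2'; case: (mxtens_indexP y') => b1' b2'.
by rewrite [RHS]mxE !jointE !mxE mulrA.
Qed.

Lemma jointZr dA dB mA mB (c : C) (rho : 'M[C]_(dA * dB)) (mu : 'M[C]_(mA * mB)) :
  joint rho (c *: mu) = c *: joint rho mu.
Proof.
apply/matrixP=> k l.
case: (mxtens_indexP k) => x y; case: (mxtens_indexP l) => x' y'.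
case: (mxtens_indexP x) => a1 a2; case: (mxtens_indexP y) => b1 b2.
case: (mxtens_indexP x') => a1' a2'; case: (mxtens_indexP y') => b1' b2'.
by rewrite [RHS]mxE !jointE !mxE mulrCA.
Qed.

Lemma tr_joint dA dB mA mB (rho : 'M[C]_(dA * dB)) (mu : 'M[C]_(mA * mB)) :
  \tr (joint rho mu) = \tr rho * \tr mu.
Proof.
rewrite {1}/mxtrace sum_tens sum_tens.
under eq_bigr => a _ do under eq_bigr => k _ do rewrite sum_tens.
rewrite /mxtrace (sum_tens (fun i => rho i i)) (sum_tens (fun i => mu i i)).
rewrite big_distrl /=; apply: eq_bigr => a _.
rewrite [in RHS]big_distrl /= exchange_big /=; apply: eq_bigr => b _.
rewrite mulr_sumr; apply: eq_bigr => k _; rewrite mulr_sumr.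
by apply: eq_bigr => l _; rewrite jointE.
Qed.
End Vectorization.

(** * LOCC protocols *)

Section Protocols.
Variables (R : realType) (O : eqType) (aF bF : nat).
Local Notation C := R[i].
Implicit Types (a b : nat).

(** Every leaf carries one label and [labels] is duplicate-free, so grouping by label counts each
    Kraus operator once. *)
Lemma sum_kraus_labels (V : nmodType) a b (p : proto R O aF bF a b)
    (f : O * 'M[C]_(aF * bF, a * b) -> V) :
  \sum_(o <- labels p) \sum_(x <- kraus p | x.1 == o) f x = \sum_(x <- kraus p) f x.
Proof.
rewrite (exchange_big_dep xpredT) //= !big_seq; apply: eq_bigr => x xp.
have xl : x.1 \in labels p by rewrite mem_undup map_f.
by rewrite big_mkcond (bigD1_seq x.1) ?undup_uniq //= eqxx big1 ?addr0 // => o;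
   rewrite eq_sym => /negPf ->.
Qed.

(** Induction on the tree: the operators of each subtree sum to the identity, which leaves the local
    completeness relation tensored with the identity of the other party. *)
Lemma kraus_complete a b (p : proto R O aF bF a b) :
  proto_wf p -> \sum_(x <- kraus p) adj x.2 *m x.2 = 1%:M.
Proof.
elim: p => {a b} [o|a b k a' K next IH|a b k b' L next IH] /=.
- by rewrite big_cons big_nil addr0 adj_id mul1mx.
- case=> sK wf; rewrite big_flatten big_map big_enum /=.
  transitivity (\sum_i (adj (K i) *m K i) *t (1%:M : 'M[C]_b)).
    apply: eq_bigr => i _; rewrite big_map /=.
    under eq_bigr => x _ do rewrite adj_mul mulmxA -(mulmxA (adj (_ *t _))).
    by rewrite -mulmx_suml -mulmx_sumr IH // mulmx1 adj_tens adj_id tensmx_mul mul1mx.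
  apply/matrixP=> x y; rewrite summxE.
  case: (mxtens_indexP x) => i j; case: (mxtens_indexP y) => i' j'.
  under eq_bigr => z _ do rewrite tensmxE.
  by rewrite -mulr_suml -summxE sK !mxE mxtens_eq -natrM mulnb.
- case=> sL wf; rewrite big_flatten big_map big_enum /=.
  transitivity (\sum_i (1%:M : 'M[C]_a) *t (adj (L i) *m L i)).
    apply: eq_bigr => i _; rewrite big_map /=.
    under eq_bigr => x _ do rewrite adj_mul mulmxA -(mulmxA (adj (_ *t _))).
    by rewrite -mulmx_suml -mulmx_sumr IH // mulmx1 adj_tens adj_id tensmx_mul mul1mx.
  apply/matrixP=> x y; rewrite summxE.
  case: (mxtens_indexP x) => i j; case: (mxtens_indexP y) => i' j'.
  under eq_bigr => z _ do rewrite tensmxE.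
  by rewrite -mulr_sumr -summxE sL !mxE mxtens_eq -natrM mulnb.
Qed.

Lemma tens1 a b : (1%:M : 'M[C]_a) *t (1%:M : 'M[C]_b) = 1%:M.
Proof.
apply/matrixP=> x y.
case: (mxtens_indexP x) => i j; case: (mxtens_indexP y) => i' j'.
by rewrite tensmxE !mxE mxtens_eq -natrM mulnb.
Qed.

Lemma kraus_product a b (p : proto R O aF bF a b) x :
  x \in kraus p -> exists K L, x.2 = K *t L.
Proof.
elim: p x => {a b} [o|a b k a' K next IH|a b k b' L next IH] x /=.
- by rewrite inE => /eqP ->; exists 1%:M, 1%:M; rewrite tens1.
- move=> /flattenP[s /mapP[i _ ->]] /mapP[y /IH [A [B E]]] -> /=.
  by rewrite E tensmx_mul; eauto.
- move=> /flattenP[s /mapP[i _ ->]] /mapP[y /IH [A [B E]]] -> /=.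
  by rewrite E tensmx_mul; eauto.
Qed.

Lemma tr_chan_out a b (p : proto R O aF bF a b) X : proto_wf p ->
  \sum_(o <- labels p) \tr (chan_out p o X) = \tr X.
Proof.
move=> wf; under eq_bigr => o _ do rewrite raddf_sum.
rewrite (sum_kraus_labels p (fun x => \tr (x.2 *m X *m adj x.2))).
under eq_bigr => x _ do rewrite mxtrace_mulC mulmxA.
by rewrite -raddf_sum -mulmx_suml kraus_complete // mul1mx.
Qed.

Lemma chan_outD a b (p : proto R O aF bF a b) o X Y :
  chan_out p o (X + Y) = chan_out p o X + chan_out p o Y.
Proof.
rewrite /chan_out -big_split; apply: eq_bigr => x _ /=.
by rewrite mulmxDr mulmxDl.
Qed.

Lemma chan_outZ a b (p : proto R O aF bF a b) o (c : C) X :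
  chan_out p o (c *: X) = c *: chan_out p o X.
Proof.
rewrite /chan_out scaler_sumr; apply: eq_bigr => x _ /=.
by rewrite -scalemxAr -scalemxAl.
Qed.

Lemma chan_out_joint_mix dA dB mA mB (p : proto R O aF bF (dA * mA) (dB * mB)) o
    (c c' : C) (X Y : 'M[C]_(dA * dB)) (mu : 'M[C]_(mA * mB)) :
  chan_out p o (joint (c *: X + c' *: Y) mu) =
  c *: chan_out p o (joint X mu) + c' *: chan_out p o (joint Y mu).
Proof.
by rewrite jointDl chan_outD (jointZl c) (jointZl c') (chan_outZ _ _ c) (chan_outZ _ _ c').
Qed.

(* A domination that holds for every product operator bounds all LOCC
   measurements: separability of the Kraus operators is all that is used. *)
Lemma locc_sum_le a b (p : proto R O aF bF a b) (X Z : 'M[C]_(a * b)) :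
  proto_wf p ->
  (forall a' b' (K : 'M[C]_(a', a)) (L : 'M[C]_(b', b)),
    `|\tr ((K *t L) *m X *m adj (K *t L))| <= \tr ((K *t L) *m Z *m adj (K *t L))) ->
  \sum_(o <- labels p) complex.Re `|\tr (povm p o *m X)| <= complex.Re (\tr Z).
Proof.
move=> wf dom.
have trE (x : O * 'M[C]_(aF * bF, a * b)) Y :
    \tr (adj x.2 *m x.2 *m Y) = \tr (x.2 *m Y *m adj x.2).
  by rewrite -mulmxA mxtrace_mulC.
suff: \sum_(o <- labels p) `|\tr (povm p o *m X)| <= \tr Z.
  by rewrite lecE -raddf_sum => /andP[_].
have -> : \tr Z = \sum_(x <- kraus p) \tr (x.2 *m Z *m adj x.2).
  under eq_bigr => x _ do rewrite -trE.
  by rewrite -raddf_sum -mulmx_suml kraus_complete // mul1mx.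
rewrite -(sum_kraus_labels p (fun x => \tr (x.2 *m Z *m adj x.2))).
apply: ler_sum => o _; rewrite /povm mulmx_suml raddf_sum.
apply: le_trans (ler_norm_sum _ _ _) _.
rewrite big_seq_cond [leRHS]big_seq_cond; apply: ler_sum => x /andP[/kraus_product[K [L E]] _].
by rewrite /= trE E; exact: dom.
Qed.

(** * Protocols in which Alice measures first and Bob adapts to her outcome *)

Section OneWay.
Variables (I J : finType) (a b : nat).
Variables (K : I -> 'M[C]_(aF, a)) (L : I -> J -> 'M[C]_(bF, b)) (lab : I -> J -> O).

Definition oneway : proto R O aF bF a b :=
  PAlice (a' := fun _ : 'I_#|I| => aF) (fun i => K (enum_val i)) (fun i =>
    PBob (b' := fun _ : 'I_#|J| => bF) (fun j => L (enum_val i) (enum_val j))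
      (fun j => PLeaf R aF bF (lab (enum_val i) (enum_val j)))).

Lemma sum_enum_val (T : finType) (V : nmodType) (f : T -> V) :
  \sum_(i < #|T|) f (enum_val i) = \sum_i f i.
Proof. by rewrite [RHS](reindex (@enum_val _ T)) //; apply/onW_bij/enum_val_bij. Qed.

Lemma oneway_wf : \sum_i adj (K i) *m K i = 1%:M ->
  (forall i, \sum_j adj (L i j) *m L i j = 1%:M) -> proto_wf oneway.
Proof.
move=> sK sL; split=> /=.
  by rewrite (sum_enum_val (fun i => adj (K i) *m K i)).
move=> i; split=> //.
by rewrite (sum_enum_val (fun j => adj (L (enum_val i) j) *m L (enum_val i) j)).
Qed.

Lemma chan_out_oneway o X : chan_out oneway o X =
  \sum_i \sum_(j | lab i j == o) (K i *t L i j) *m X *m adj (K i *t L i j).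
Proof.
rewrite /chan_out /= big_flatten big_map big_enum /=.
rewrite -[RHS](sum_enum_val (fun i => \sum_(j | lab i j == o) _)) /=.
apply: eq_bigr => i _.
rewrite big_map /= big_flatten big_map big_enum /= [RHS]big_mkcond.
rewrite -[RHS](sum_enum_val (fun j => if lab _ j == o then _ else 0)) /=.
apply: eq_bigr => j _; rewrite big_mkcond big_cons big_nil /=.
by case: ifP => _; rewrite addr0 // mul1mx tensmx_mul mul1mx mulmx1.
Qed.
End OneWay.
End Protocols.


(** * Orthogonality through the swap *)

Section TraceNorm.
Variable R : realType.
Local Notation C := R[i].

Lemma ReB (x y : C) : complex.Re (x - y) = complex.Re x - complex.Re y.
Proof. exact: raddfB. Qed.

(** Expand [||v - U v||^2 >= 0]: by unitarity the two square terms agree, which leaves twice the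
    trace minus twice the real part. *)
Lemma Re_tr_unitary_vproj a b (U : 'M[C]_(a * b)) (Psi : 'M[C]_(a, b)) :
  unitary U -> complex.Re (\tr (U *m vproj Psi)) <= complex.Re (\tr (vproj Psi)).
Proof.
move=> uU; have uE : adj U *m U = 1%:M := uU; set v := cvec Psi; set w := v - U *m v.
have w0 : 0 <= \tr (adj w *m w).
  by apply: sumr_ge0 => i _; rewrite mxE sumr_ge0 // => j _; rewrite adj_entry mulrC mul_conjC_ge0.
set z := \tr (U *m vproj Psi).
have zE : z = \tr (adj v *m (U *m v)) by rewrite mxtrace_mulC -mulmxA.
have vE : \tr (vproj Psi) = \tr (adj v *m v) by rewrite mxtrace_mulC.
have adjw : adj w = adj v - adj v *m adj U.
  by apply/matrixP=> i j; rewrite /w -adj_mul adj_entry !mxE rmorphB.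
have zcE : z^* = \tr (adj v *m adj U *m v).
  by rewrite zE -tr_adj !adj_mul adj_invol.
have : \tr (adj w *m w) = \tr (vproj Psi) *+ 2 - (z + z^*).
  rewrite adjw /w mulmxBl !mulmxBr !mulmxA -(mulmxA (adj v) (adj U) U) uE mulmx1.
  rewrite !raddfB /= zcE zE vE !mulmxA mulr2n.
  by ring.
move=> E; move: w0; rewrite E lecE => /andP[_].
by case: z {zE zcE E} => x y; case: (\tr (vproj Psi)) => x' y' /=; lra.
Qed.

Lemma unitaryN n (U : 'M[C]_n) : unitary U -> unitary (- U).
Proof.
move=> uU; rewrite /unitary -[RHS]uU.
have -> : adj (- U) = - adj U by apply/matrixP=> i j; rewrite adj_entry !mxE rmorphN.
by rewrite mulNmx mulmxN opprK.
Qed.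

(** Says that the supremum in [trnorm A] is reached at the identity. Closed under sums and
    nonnegative multiples, it passes from vectors to mixtures without diagonalisation. *)
Definition tr_bounded n (A : 'M[C]_n) : Prop := forall U : 'M[C]_n, unitary U ->
  complex.Re (\tr (U *m A)) <= complex.Re (\tr A).

Lemma tr_boundedD n (A B : 'M[C]_n) : tr_bounded A -> tr_bounded B -> tr_bounded (A + B).
Proof. by move=> tA tB U uU; rewrite mulmxDr !raddfD lerD ?tA ?tB. Qed.

Lemma tr_boundedZ n (c : C) (A : 'M[C]_n) : 0 <= c -> tr_bounded A -> tr_bounded (c *: A).
Proof.
case: c => cr ci; rewrite lecE /= => /andP[/eqP -> c0] tA U uU.
rewrite -scalemxAr !mxtraceZ.
move: (tA U uU); case: (\tr (U *m A)) => x y; case: (\tr A) => x' y' /= le.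
by rewrite !mul0r !subr0 ler_wpM2l.
Qed.

Lemma tr_bounded_sum n (I : Type) (r : seq I) (P : pred I) (F : I -> 'M[C]_n) :
  (forall i, P i -> tr_bounded (F i)) -> tr_bounded (\sum_(i <- r | P i) F i).
Proof.
move=> tF; apply: big_ind => //; last exact: tr_boundedD.
by move=> U _; rewrite mulmx0.
Qed.

Definition swap D : 'M[C]_(D * D) :=
  \matrix_(k, l) (((mxtens_unindex k).1 == (mxtens_unindex l).2)
    && ((mxtens_unindex k).2 == (mxtens_unindex l).1))%:R.

Lemma swapE D i j i' j' :
  swap D (mxtens_index (i, j)) (mxtens_index (i', j')) = ((i == j') && (j == i'))%:R.
Proof. by rewrite mxE !mxtens_indexK. Qed.

Lemma mul_swapE D n (X : 'M[C]_(D * D, n)) i j l :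
  (swap D *m X) (mxtens_index (i, j)) l = X (mxtens_index (j, i)) l.
Proof.
rewrite mxE (bigD1 (mxtens_index (j, i))) //= swapE !eqxx mul1r big1 ?addr0 // => k.
case: (mxtens_indexP k) => i' j'; rewrite mxtens_eq swapE => /negPf ne.
by rewrite andbC (eq_sym j) (eq_sym i) ne mul0r.
Qed.

Lemma swap_cvec D (Psi : 'M[C]_D) : swap D *m cvec Psi = cvec Psi^T.
Proof.
apply/matrixP=> k l; case: (mxtens_indexP k) => i j.
by rewrite mul_swapE !cvecE mxE.
Qed.

Lemma swap_unitary D : unitary (swap D).
Proof.
have adj_swap : adj (swap D) = swap D.
  apply/matrixP=> k l; case: (mxtens_indexP k) => i j; case: (mxtens_indexP l) => i' j'.
  by rewrite adj_entry !swapE rmorph_nat andbC (eq_sym j') (eq_sym i').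
rewrite /unitary adj_swap; apply/matrixP=> k l.
case: (mxtens_indexP k) => i j; case: (mxtens_indexP l) => i' j'.
by rewrite mul_swapE swapE mxE mxtens_eq andbC.
Qed.

Lemma swap_vproj D (s : C) (Psi : 'M[C]_D) :
  Psi^T = s *: Psi -> swap D *m vproj Psi = s *: vproj Psi.
Proof.
move=> E; rewrite /vproj mulmxA swap_cvec E scalemxAl; congr (_ *m _).
by apply/matrixP=> k l; rewrite !mxE.
Qed.

(** The swap is an optimal unitary: it acts as [+1] on [rho0] and as [-1] on [rho1], so it reaches
    the value 2, which is also the bound given by the two traces. *)
Lemma P_opt_swap D (rho0 rho1 : 'M[C]_(D * D)) :
  tr_bounded rho0 -> tr_bounded rho1 -> \tr rho0 = 1 -> \tr rho1 = 1 ->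
  swap D *m rho0 = rho0 -> swap D *m rho1 = - rho1 -> P_opt rho0 rho1 = 1.
Proof.
move=> b0 b1 t0 t1 s0 s1; suff -> : P_opt rho0 rho1 = 2^-1 + 4^-1 * 2%:R.
  by lra.
congr (_ + _ * _); rewrite /trnorm.
set S := (X in sup X).
have ub : ubound S 2%:R.
  move=> _ [U [uU ->]]; rewrite mulmxBr [\tr _]raddfB ReB.
  have := b0 U uU; have := b1 _ (unitaryN uU).
  by rewrite mulNmx [\tr (- _)]raddfN [complex.Re (- _)]raddfN t0 t1 /=; lra.
have S2 : S 2%:R.
  exists (swap D); split; first exact: swap_unitary.
  by rewrite mulmxBr s0 s1 opprK raddfD /= t0 t1.
apply/eqP; rewrite eq_le; apply/andP; split.
  by apply: ge_sup => //; exists 2%:R.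
by apply: ub_le_sup => //; exists 2%:R.
Qed.
End TraceNorm.


(** * The hiding states with public refill *)

Section Hiding.
Variable R : realType.
Local Notation C := R[i].

Lemma locc_norm_le dA dB (X Z : 'M[C]_(dA * dB)) :
  (forall a' b' (K : 'M[C]_(a', dA)) (L : 'M[C]_(b', dB)),
    `|\tr ((K *t L) *m X *m adj (K *t L))| <= \tr ((K *t L) *m Z *m adj (K *t L))) ->
  locc_norm X <= complex.Re (\tr Z).
Proof.
move=> dom; rewrite /locc_norm.
set S := (X in sup X).
have ub : ubound S (complex.Re (\tr Z)).
  by move=> _ [p [wf ->]]; apply: locc_sum_le.
(* The supremum of the empty set is 0; in that case the domination at the identity operators gives
   [0 <= \tr Z]. *)
have [-> | ne] := eqVneq S set0; last by apply: ge_sup => //; apply/set0P.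
have := dom _ _ 1%:M 1%:M; rewrite sup0 tens1 adj_id !mul1mx !mulmx1 => le.
by have := le_trans (normr_ge0 _) le; rewrite lecE => /andP[_].
Qed.

Lemma norm_diff_le (c c' s g t u : C) : 0 <= c -> 0 <= c' ->
  0 <= s -> 0 <= g -> 0 <= t -> 0 <= u ->
  `|c * (s - g) + c' * (t - u)| <= c * (s + g) + c' * (t + u).
Proof.
move=> c0 c'0 s0 g0 t0 u0; apply: le_trans (ler_normD _ _) _.
rewrite !normrM (ger0_norm c0) (ger0_norm c'0) lerD // ler_wpM2l //.
  by apply: le_trans (ler_normB _ _) _; rewrite !ger0_norm.
by apply: le_trans (ler_normB _ _) _; rewrite !ger0_norm.
Qed.

(** A signed combination of terms on which [f] is nonnegative is dominated by the same combination
    with all signs positive. The functional [f] will be the trace after a product Kraus operator. *)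
Lemma norm_scalar_diff_le (V : lmodType C) (f : V -> C) (c c' : C) (S G T U : V) :
  {morph f : x y / x + y} -> (forall a x, f (a *: x) = a * f x) ->
  0 <= c -> 0 <= c' -> 0 <= f S -> 0 <= f G -> 0 <= f T -> 0 <= f U ->
  `|f (c *: (S - G) + c' *: (T - U))| <= f (c *: (S + G) + c' *: (T + U)).
Proof.
move=> fD fZ c0 c'0 S0 G0 T0 U0.
have fN x : f (- x) = - f x by rewrite -scaleN1r fZ mulN1r.
by rewrite !(fD, fZ, fN); apply: norm_diff_le.
Qed.

Lemma tr_conjD m n (K : 'M[C]_(m, n)) :
  {morph (fun X => \tr (K *m X *m adj K)) : X Y / X + Y}.
Proof. by move=> X Y; rewrite mulmxDr mulmxDl mxtraceD. Qed.

Lemma tr_conjZ m n (K : 'M[C]_(m, n)) c X :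
  \tr (K *m (c *: X) *m adj K) = c * \tr (K *m X *m adj K).
Proof. by rewrite -scalemxAr -scalemxAl mxtraceZ. Qed.

Lemma mixture_diff n (a b k : C) (H0 H1 T0 T1 W : 'M[C]_n) : H0 - H1 = k *: W ->
  a *: H0 + b *: T0 - (a *: H1 + b *: T1) = (a * k) *: W + b *: (T0 - T1).
Proof. by move=> E; rewrite opprD addrACA -!scalerBr E scalerA. Qed.

Definition cross a b (A B : 'M[C]_(a, b)) : 'M[C]_(a * b) := cvec A *m adj (cvec B).

Lemma tr_cross a b (A B : 'M[C]_(a, b)) :
  \tr (cross A B) = \sum_i \sum_j A i j * (B i j)^*.
Proof.
rewrite /mxtrace sum_tens; apply: eq_bigr => i _; apply: eq_bigr => j _.
by rewrite mxE big_ord1 adj_entry !cvecE.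
Qed.

Lemma tens_cross a b a' b' (K : 'M[C]_(a', a)) (L : 'M_(b', b)) A B :
  (K *t L) *m cross A B *m adj (K *t L) = cross (K *m A *m L^T) (K *m B *m L^T).
Proof. by rewrite /cross -!tens_cvec adj_mul !mulmxA. Qed.

(** Polarisation: subtracting the antisymmetric projector from the symmetric one leaves only the
    cross terms, which are swap terms. *)
Lemma vproj_polar a b (A B : 'M[C]_(a, b)) :
  vproj (A + B) - vproj (A - B) = 2%:R *: (cross A B + cross B A).
Proof.
apply/matrixP=> k l; case: (mxtens_indexP k) => i j; case: (mxtens_indexP l) => i' j'.
rewrite !(mxE, big_ord1) !mxtens_indexK /= rmorphB rmorphD; ring.
Qed.

(* The partially transposed swap of a subspace is positive; this is why the
   swap has small expectation on every LOCC effect. *)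
Lemma tr_tens_swap_ge0 D a' b' (I : finType) (e : I -> 'I_D)
    (K : 'M[C]_(a', D)) (L : 'M[C]_(b', D)) :
  0 <= \tr ((K *t L) *m (\sum_x \sum_y cross (delta_mx (e x) (e y)) (delta_mx (e y) (e x)))
            *m adj (K *t L)).
Proof.
have kdl x y i j : (K *m delta_mx (e x) (e y) *m L^T) i j = K i (e x) * L j (e y).
  rewrite mxE (bigD1 (e y)) //= big1 ?addr0 => [|z /negPf ne].
    rewrite mxE (bigD1 (e x)) //= big1 ?addr0 => [|z /negPf ne].
      by rewrite !mxE !eqxx mulr1.
    by rewrite mxE ne mulr0.
  rewrite mxE big1 ?mul0r // => w _.
  by rewrite mxE ne andbF mulr0.
rewrite mulmx_sumr mulmx_suml raddf_sum /=.
(* The factors depending on [x] and on [y] separate into a number and its conjugate; conjugating the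
   entries of [L] is the partial transpose on Bob's side. *)
have -> : \sum_x \tr ((K *t L) *m (\sum_y cross (delta_mx (e x) (e y)) (delta_mx (e y) (e x)))
            *m adj (K *t L)) =
    \sum_i \sum_j `|\sum_x K i (e x) * (L j (e x))^*| ^+ 2.
  under eq_bigr => x _.
    rewrite mulmx_sumr mulmx_suml raddf_sum /=.
    under eq_bigr => y _ do rewrite tens_cross tr_cross.
    over.
  under eq_bigr => x _ do rewrite exchange_big /=.
  rewrite exchange_big /=; apply: eq_bigr => i _.
  under eq_bigr => x _ do rewrite exchange_big /=.
  rewrite exchange_big /=; apply: eq_bigr => j _.
  rewrite normCK rmorph_sum mulr_suml; apply: eq_bigr => x _.
  rewrite mulr_sumr; apply: eq_bigr => y _.
  by rewrite !kdl !rmorphM /= conjCK; ring.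
by apply: sumr_ge0 => i _; apply: sumr_ge0 => j _; rewrite exprn_ge0.
Qed.

Lemma tr_vproj_mul a b (Psi : 'M[C]_(a, b)) : \tr (vproj Psi) = \tr (Psi *m adj Psi).
Proof.
rewrite tr_vproj; apply: eq_bigr => i _; rewrite mxE; apply: eq_bigr => j _.
by rewrite adj_entry normCK.
Qed.

Variables (d' N : nat) (p : R).
Hypothesis N_gt0 : (0 < N)%N.
Hypotheses (p_ge0 : 0 <= p) (p_le1 : p <= 1).
Let d := d'.+2.

(* Each party holds either a vector of the hiding space or a flagged half of a
   maximally entangled state of rank [N] together with one extra bit. *)
Definition side : finType := ('I_d + bool * 'I_N)%type.
Local Notation D := #|{: side}|.
Let e (x : 'I_d) : 'I_D := enum_rank (inl x : side).
Let E (x y : 'I_d) : 'M[C]_D := delta_mx (e x) (e y).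

Lemma e_inj : injective e.
Proof. by move=> x y /enum_rank_inj[]. Qed.

Definition hide_vec (z : bool) x y : 'M[C]_D := E x y + (-1) ^+ z *: E y x.

(** Bell states on the flag bits: [00 + 11] for [z = false], [01 - 10] for [z = true]. The parity of
    the bits reveals [z], and the sign gives the vector the same swap symmetry as the hiding
    vectors. *)
Definition refill_coef (z : bool) (a b : side) : C :=
  match a, b with
  | inr (b1, u), inr (b2, v) => ((u == v) && (b1 (+) b2 == z))%:R * (-1) ^+ (b1 && z)
  | _, _ => 0
  end.

Definition refill_vec z : 'M[C]_D :=
  \matrix_(i, j) refill_coef z (enum_val i) (enum_val j).

(** There are [d * (d - 1)] ordered pairs [x != y], each with a vector of squared norm 2; [d >= 2]
    keeps the denominator nonzero. *)
Definition kappa : C := (2 * (d * d'.+1))%:R^-1.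

Definition hide_state z : 'M[C]_(D * D) :=
  kappa *: \sum_x \sum_(y | y != x) vproj (hide_vec z x y).
Definition refill_state z : 'M[C]_(D * D) :=
  (2 * N)%:R^-1 *: vproj (refill_vec z).
Definition rho z : 'M[C]_(D * D) :=
  (1 - p)%:C%C *: hide_state z + p%:C%C *: refill_state z.

Lemma sign_conj (z : bool) : ((-1) ^+ z)^* = (-1) ^+ z :> C.
Proof. by rewrite rmorphXn rmorphN1. Qed.

Lemma hide_vecT z x y : (hide_vec z x y)^T = (-1) ^+ z *: hide_vec z x y.
Proof.
rewrite /hide_vec linearD linearZ /= !trmx_delta scalerDr scalerA -expr2 sqrr_sign.
by rewrite scale1r addrC.
Qed.

Lemma refill_vecT z : (refill_vec z)^T = (-1) ^+ z *: refill_vec z.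
Proof.
apply/matrixP=> i j; rewrite !mxE.
case: (enum_val i) => [x|[b1 u]]; case: (enum_val j) => [y|[b2 v]] /=; rewrite ?mulr0 //.
rewrite (eq_sym v); case: (u == v); rewrite ?mul0r ?mulr0 //=.
by case: b1; case: b2; case: z; rewrite /= ?expr0 ?expr1 ?mulr1 ?mul0r ?mulr0 ?mul1r ?mulN1r ?opprK.
Qed.

Lemma tr_hide_vec z x y : y != x -> \tr (vproj (hide_vec z x y)) = 2%:R.
Proof.
move=> ne; have /negPf neE : e x != e y by rewrite (inj_eq e_inj) eq_sym.
have adjE x' y' : adj (E x' y') = E y' x'.
  by apply/matrixP=> i j; rewrite adj_entry !mxE rmorph_nat andbC.
rewrite tr_vproj_mul /hide_vec adj_add adj_scale sign_conj !adjE.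
rewrite mulmxDl !mulmxDr -!scalemxAl -!scalemxAr !mul_delta_mx_cond !eqxx neE eq_sym neE.
rewrite !mulr0n !scaler0 !mulr1n addr0 add0r scalerA -expr2 sqrr_sign scale1r.
have trd (i : 'I_D) : \tr (delta_mx i i : 'M[C]_D) = 1.
  by rewrite /mxtrace (bigD1 i) //= mxE !eqxx big1 ?addr0 // => j /negPf nj; rewrite mxE nj.
by rewrite raddfD /= !trd.
Qed.

Lemma tr_refill_vec z : \tr (vproj (refill_vec z)) = (2 * N)%:R.
Proof.
rewrite tr_vproj.
under eq_bigr => i _ do under eq_bigr => j _ do rewrite mxE.
rewrite (sum_enum_val (fun i => \sum_j `|refill_coef z i (enum_val j)| ^+ 2)).
under eq_bigr => i _ do rewrite (sum_enum_val (fun j => `|refill_coef z i j| ^+ 2)).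
rewrite big_sumType /= big1 ?add0r => [|x _]; last first.
  by apply: big1 => j _; rewrite normr0 expr0n.
transitivity (\sum_(i : bool * 'I_N) (1 : C)).
  apply: eq_bigr => -[b u] _; rewrite big_sumType /= big1 ?add0r => [|x _]; last first.
    by rewrite normr0 expr0n.
  rewrite (bigD1 (b (+) z, u)) //= big1 => [|[b2 v] /negPf ne].
    by rewrite eqxx addKb eqxx mul1r normrX normrN1 expr1n expr1n addr0.
  case: eqP => [uv|_]; last by rewrite mul0r normr0 expr0n.
  case: eqP => [bz|_]; last by rewrite mul0r normr0 expr0n.
  by move: ne; rewrite -bz addKb uv eqxx.
by rewrite sumr_const card_prod card_bool card_ord.
Qed.

Lemma kappa_ge0 : 0 <= kappa. Proof. by rewrite invr_ge0 ler0n. Qed.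

Lemma tr_hide_state z : \tr (hide_state z) = 1.
Proof.
rewrite mxtraceZ raddf_sum /=.
have -> : \sum_(x < d) \tr (\sum_(y < d | y != x) vproj (hide_vec z x y)) = (2 * (d * d'.+1))%:R.
  transitivity (\sum_(x < d) (d'.+1 * 2)%:R : C); last first.
    by rewrite sumr_const card_ord -mulrnA mulnC [(_ * 2)%N]mulnC mulnCA.
  apply: eq_bigr => x _; rewrite raddf_sum /=.
  under eq_bigr => y ne do rewrite tr_hide_vec //.
  rewrite sumr_const -[X in _ *+ X]/#|predC1 x| cardC1 card_ord.
  by rewrite mulnC mulrnA.
by rewrite mulVf // pnatr_eq0.
Qed.

Lemma tr_refill_state z : \tr (refill_state z) = 1.
Proof.
by rewrite mxtraceZ tr_refill_vec mulVf // pnatr_eq0 muln_eq0 /= -lt0n.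
Qed.

Lemma p_geC : 0 <= p%:C%C. Proof. by rewrite ler0c. Qed.
Lemma q_geC : 0 <= (1 - p)%:C%C. Proof. by rewrite ler0c subr_ge0. Qed.
Lemma invN_ge0 : 0 <= (2 * N)%:R^-1 :> C. Proof. by rewrite invr_ge0 ler0n. Qed.

Lemma tr_rho z : \tr (rho z) = 1.
Proof.
rewrite mxtraceD (mxtraceZ _ (hide_state z)) (mxtraceZ _ (refill_state z)).
by rewrite tr_hide_state tr_refill_state !mulr1 -rmorphD subrK.
Qed.

Lemma psd_refill_state z : psd (refill_state z).
Proof. exact: psdZ invN_ge0 (psd_vproj _). Qed.

Lemma rho_state z : is_state (rho z).
Proof.
split; last exact: tr_rho.
apply: psdD; apply: psdZ; rewrite ?q_geC ?p_geC //; last exact: psd_refill_state.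
apply: psdZ kappa_ge0 _; apply: psd_sum => x _; apply: psd_sum => y _.
exact: psd_vproj.
Qed.

Lemma tr_bounded_rho z : tr_bounded (rho z).
Proof.
have bv a b (Psi : 'M[C]_(a, b)) : tr_bounded (vproj Psi).
  by move=> U; apply: Re_tr_unitary_vproj.
apply: tr_boundedD; apply: tr_boundedZ; rewrite ?q_geC ?p_geC //; last first.
  exact: tr_boundedZ invN_ge0 (bv _ _ _).
apply: tr_boundedZ kappa_ge0 _.
by apply: tr_bounded_sum => x _; apply: tr_bounded_sum => y _; apply: bv.
Qed.

Lemma swap_rho z : swap R D *m rho z = (-1) ^+ z *: rho z.
Proof.
have hideE : swap R D *m hide_state z = (-1) ^+ z *: hide_state z.
  rewrite -scalemxAr scalerA mulrC -scalerA; congr (_ *: _).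
  rewrite mulmx_sumr scaler_sumr; apply: eq_bigr => x _.
  rewrite mulmx_sumr scaler_sumr; apply: eq_bigr => y _.
  exact: swap_vproj (hide_vecT _ _ _).
have refillE : swap R D *m refill_state z = (-1) ^+ z *: refill_state z.
  by rewrite -scalemxAr (swap_vproj (refill_vecT z)) !scalerA mulrC.
rewrite mulmxDr scalerDr -(scalemxAr _ _ (hide_state z)) -(scalemxAr _ _ (refill_state z)).
by rewrite hideE refillE !scalerA !(mulrC ((-1) ^+ z)).
Qed.

Lemma P_opt_rho : P_opt (rho false) (rho true) = 1.
Proof.
apply: P_opt_swap; rewrite ?tr_rho //; try exact: tr_bounded_rho.
  by rewrite swap_rho scale1r.
by rewrite swap_rho scaleN1r.
Qed.

(** Polarisation gives two cross terms per ordered pair, with equal sums after exchanging [x] and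
    [y], hence the factor 4. The off-diagonal swap is written as full swap minus diagonal because
    both of these are nonnegative on product operators. *)
Lemma hide_diff : hide_state false - hide_state true =
  (4%:R * kappa) *: (\sum_x \sum_y cross (E x y) (E y x) - \sum_x vproj (E x x)).
Proof.
rewrite -scalerBr [4%:R * _]mulrC -[RHS]scalerA; congr (_ *: _).
rewrite -sumrB; under eq_bigr => x _ do rewrite -sumrB.
have -> : \sum_x \sum_(y | y != x) (vproj (hide_vec false x y) - vproj (hide_vec true x y)) =
  \sum_x \sum_(y | y != x) 2%:R *: (cross (E x y) (E y x) + cross (E y x) (E x y)).
  apply: eq_bigr => x _; apply: eq_bigr => y _.
  by rewrite /hide_vec expr0 scale1r expr1 scaleN1r vproj_polar.
transitivity (4%:R *: \sum_x \sum_(y | y != x) cross (E x y) (E y x)).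
  rewrite scaler_sumr; under eq_bigr => x _ do rewrite -scaler_sumr big_split /= scalerDr.
  rewrite big_split /=.
  have -> : \sum_x 2%:R *: \sum_(y | y != x) cross (E y x) (E x y) =
            \sum_x 2%:R *: \sum_(y | y != x) cross (E x y) (E y x).
    rewrite -!scaler_sumr; congr (_ *: _).
    rewrite (exchange_big_dep xpredT) //=; apply: eq_bigr => x _.
    by apply: eq_bigl => y; rewrite eq_sym.
  rewrite -big_split /=; apply: eq_bigr => x _.
  by rewrite -scalerDl -natrD.
congr (_ *: _); rewrite -sumrB; apply: eq_bigr => x _.
by rewrite [X in _ = X - _](bigD1 x) //= addrC addrK.
Qed.

(** Only the terms [x = y] survive. A trace of [d], against the [d * (d - 1)] pairs in [kappa], is
    the source of the [O(1/d)] bias. *)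
Lemma tr_swap_part : \tr (\sum_x \sum_y cross (E x y) (E y x)) = d%:R.
Proof.
rewrite raddf_sum /=; transitivity (\sum_(x < d) (1 : C)); last first.
  by rewrite sumr_const card_ord.
apply: eq_bigr => x _; rewrite raddf_sum /= (bigD1 x) //= big1 ?addr0 => [|y ne].
  rewrite tr_cross (bigD1 (e x)) //= (bigD1 (e x)) //= !mxE !eqxx conjC1 mulr1.
  rewrite !big1 ?addr0 // => [i /negPf ne|i /negPf ne].
    by apply: big1 => j _; rewrite !mxE ne mul0r.
  by rewrite !mxE ne andbF mul0r.
rewrite tr_cross big1 // => i _; rewrite big1 // => j _; rewrite !mxE rmorph_nat -natrM mulnb.
case: eqP => //= ->; case: eqP => //= ->.
by rewrite (inj_eq e_inj) eq_sym (negPf ne).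
Qed.

Lemma tr_diag_part : \tr (\sum_x vproj (E x x)) = d%:R.
Proof.
rewrite raddf_sum /=; transitivity (\sum_(x < d) (1 : C)); last first.
  by rewrite sumr_const card_ord.
apply: eq_bigr => x _; rewrite tr_vproj (bigD1 (e x)) //= (bigD1 (e x)) //= !mxE !eqxx.
rewrite normr1 expr1n !big1 ?addr0 // => [i /negPf ne|i /negPf ne].
  by apply: big1 => j _; rewrite !mxE ne normr0 expr0n.
by rewrite !mxE ne andbF normr0 expr0n.
Qed.

Lemma locc_norm_rho : locc_norm (rho false - rho true) <= 4%:R / d'.+1%:R + 2%:R * p.
Proof.
pose S := \sum_x \sum_y cross (E x y) (E y x); pose G := \sum_x vproj (E x x).
pose c := (1 - p)%:C%C * (4%:R * kappa).
have c_ge0 : 0 <= c by rewrite !mulr_ge0 ?q_geC ?kappa_ge0 ?ler0n.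
(* [Z] is the difference of the two states with every minus sign turned into plus, so its trace
   bounds the LOCC norm. *)
pose Z := c *: (S + G) + p%:C%C *: (refill_state false + refill_state true).
have XE : rho false - rho true = c *: (S - G) + p%:C%C *: (refill_state false - refill_state true).
  exact: mixture_diff hide_diff.
have trZ : complex.Re (\tr Z) <= 4%:R / d'.+1%:R + 2%:R * p.
  rewrite /Z mxtraceD (mxtraceZ c) (mxtraceZ p%:C%C (_ + _)) !mxtraceD.
  rewrite tr_swap_part tr_diag_part !tr_refill_state.
  have -> : c * (d%:R + d%:R) = ((1 - p) * (4%:R / d'.+1%:R))%:C%C.
    rewrite /c -mulrA rmorphM; congr (_ * _).
    rewrite fmorph_div !rmorph_nat /kappa !natrM.
    by field; rewrite addrC natr1 !pnatr_eq0.
  have t0 : 0 <= 4%:R / d'.+1%:R :> R by rewrite divr_ge0 ?ler0n.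
  by have := mulr_ge0 p_ge0 t0; rewrite /=; set t := 4%:R / _; lra.
apply: le_trans trZ; apply: locc_norm_le => a' b' K L.
have S0 := tr_tens_swap_ge0 e K L; rewrite -/S in S0.
have G0 : 0 <= \tr ((K *t L) *m G *m adj (K *t L)).
  by apply: psd_tr; apply: psd_conj; apply: psd_sum => x _; apply: psd_vproj.
have T0 z : 0 <= \tr ((K *t L) *m refill_state z *m adj (K *t L)).
  by apply: psd_tr; apply: psd_conj; apply: psd_refill_state.
rewrite XE.
exact: norm_scalar_diff_le (tr_conjD _) (tr_conjZ _) c_ge0 p_geC S0 G0 (T0 false) (T0 true).
Qed.

Lemma P_LOCC_rho : P_LOCC (rho false) (rho true) <= 2^-1 + (d'.+1%:R^-1 + p / 2%:R).
Proof.
by rewrite /P_LOCC; have := locc_norm_rho; set t := d'.+1%:R^-1; lra.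
Qed.

End Hiding.


(** * Error statistics *)

Section Geometric.
Variable R : realType.

Lemma expr_bernoulli (x : R) n : 0 <= x -> x <= 1 -> x ^+ n * (1 + n%:R * (1 - x)) <= 1.
Proof.
move=> x0 x1; elim: n => [|n IH]; first by rewrite mul0r addr0 mulr1.
apply: le_trans IH; rewrite exprSr -mulrA ler_wpM2l ?exprn_ge0 //.
rewrite -natr1; set y := n%:R; have : 0 <= y by rewrite ler0n.
by have := sqr_ge0 (1 - x); rewrite expr2; nra.
Qed.

Lemma expr_small (x B eps : R) m : 0 <= x -> x < 1 -> 0 <= B -> 0 < eps ->
  exists n, (m <= n)%N /\ B * x ^+ n <= eps.
Proof.
move=> x0 x1 B0 e0; have y0 : 0 < 1 - x by rewrite subr_gt0.
(* Bernoulli bounds [x ^+ n] by [1 / (1 + n * (1 - x))], so [n] beyond [B / (eps * (1 - x))]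
   suffices; adding [m] ensures [m <= n]. *)
pose k := Num.bound (B / (eps * (1 - x))); exists (m + k)%N; split; first exact: leq_addr.
have Bk : B <= eps * ((m + k)%:R * (1 - x)).
  have : B / (eps * (1 - x)) <= (m + k)%:R.
    apply: le_trans (ltW (archi_boundP _)) _; first by rewrite divr_ge0 // ltW // mulr_gt0.
    by rewrite ler_nat leq_addl.
  by rewrite ler_pdivrMr ?mulr_gt0 // mulrCA.
have := expr_bernoulli (m + k) x0 (ltW x1).
have : 0 <= x ^+ (m + k) by rewrite exprn_ge0.
set X := x ^+ _; set Y := _ * (1 - x) in Bk *; nra.
Qed.
End Geometric.

Lemma size_runs (R : realType) dA dB (rho0 rho1 : 'M[R[i]]_(dA * dB)) mA mB
    (mu1 : 'M[R[i]]_(mA * mB)) strat n h :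
  h \in runs rho0 rho1 mu1 strat n -> size h.1 = n.
Proof.
elim: n h => [|n IH] h; first by rewrite inE => /eqP ->.
move=> /flattenP[l /mapP[h' /IH sz ->]] /flattenP[l' /mapP[z _ ->]] /mapP[o _ ->] /=.
by rewrite size_rcons sz.
Qed.

(** Bounds the set of rates in [R_m], so that its supremum dominates every achievable rate. For
    [r > 1] and [n >= 1] no history satisfies [S_n >= r n]. *)
Lemma achievable_le1 (R : realType) dA dB (rho0 rho1 : 'M[R[i]]_(dA * dB)) mA mB
    (mu1 : 'M[R[i]]_(mA * mB)) strat r :
  achievable rho0 rho1 mu1 strat r -> r <= 1.
Proof.
move=> ach; rewrite leNgt; apply/negP => r1.
have half_gt0 : 0 < 2^-1 :> R by rewrite invr_gt0 ltr0n.
have [n [n1]] := ach 2^-1 half_gt0 1 isT.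
rewrite /prob_Sn_ge big_seq_cond big1 => [|h /andP[hr]]; first by lra.
have : (successes h.1)%:R <= n%:R :> R by rewrite ler_nat -(size_runs hr) count_size.
have : 1 <= n%:R :> R by rewrite (ler_nat _ 1).
set a := (successes _)%:R; nra.
Qed.

(** * The memory level as a Markov chain and the number of errors *)

Section Statistics.
Variable R : realType.
Local Notation C := R[i].
Variables (dA dB mA mB : nat) (rho0 rho1 : 'M[C]_(dA * dB)).
Variable P : proto R outc mA mB (dA * mA) (dB * mB).
Variables (mu : nat -> 'M[C]_(mA * mB)) (m : nat) (p : R).
Hypothesis P_wf : proto_wf P.
Hypotheses (tr_rho0 : \tr rho0 = 1) (tr_rho1 : \tr rho1 = 1).
Hypothesis tr_mu : forall c, \tr (mu c) = 1.

Local Notation rho := (rho_of rho0 rho1).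
Local Notation out c z o := (chan_out P o (joint (rho z) (mu c))).
Local Notation runs n := (runs rho0 rho1 (mu 0) (fun=> P) n).

(* The second component of an outcome is [1] exactly when the round refilled
   the memory to level [m]; any other round consumes one level. *)
Definition next_level (c : nat) (o : outc) : nat := if o.2 == 1%N then m else c.-1.

(** Interface between the protocol and the statistics: since each outcome leaves one of the standard
    states [mu c], the quantum process reduces to a classical chain on levels, with refill
    probability [p] and errors only at level 0. *)
Hypothesis out_mu : forall c z o, (c <= m)%N ->
  exists2 k, 0 <= k & out c z o = k *: mu (next_level c o).
Hypothesis out_wrong : forall c z (o : outc), (c <= m)%N -> (0 < c)%N || (o.2 == 1%N) ->
  o.1 != z -> out c z o = 0.
Hypothesis out_refill : forall c z, (c <= m)%N ->
  complex.Re (\tr (\sum_(o <- labels P | o.2 == 1%N) out c z o)) = p.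

Lemma tr_rho_of z : \tr (rho z) = 1.
Proof. by case: z. Qed.

Definition weight c z o : R := complex.Re (\tr (out c z o)).

Lemma weight_ge0 c z o : (c <= m)%N -> 0 <= weight c z o.
Proof.
move=> /(out_mu z o)[k k0 E]; rewrite /weight E mxtraceZ tr_mu mulr1.
by move: k0; rewrite lecE => /andP[].
Qed.

Lemma out_weight c z o : (c <= m)%N -> out c z o = (weight c z o)%:C%C *: mu (next_level c o).
Proof.
move=> /(out_mu z o)[k k0 E]; rewrite /weight E mxtraceZ tr_mu mulr1.
by congr (_ *: _); case: k k0 {E} => kr ki; rewrite lecE /= => /andP[/eqP ->].
Qed.

Lemma weight_wrong c z (o : outc) : (c <= m)%N -> (0 < c)%N || (o.2 == 1%N) ->
  o.1 != z -> weight c z o = 0.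
Proof. by move=> cm co oz; rewrite /weight out_wrong // mxtrace0. Qed.

Lemma weight_refill c z : (c <= m)%N ->
  \sum_(o <- labels P | o.2 == 1%N) weight c z o = p.
Proof. by move=> cm; rewrite -(out_refill z cm) [\tr _]raddf_sum [RHS]raddf_sum. Qed.

Lemma weight_consume c z : (c <= m)%N ->
  \sum_(o <- labels P | o.2 != 1%N) weight c z o = 1 - p.
Proof.
move=> cm; apply: (addrI p); rewrite [RHS]addrC subrK -{1}(weight_refill z cm).
transitivity (\sum_(o <- labels P) weight c z o).
  by rewrite [RHS](bigID (fun o : outc => o.2 == 1%N)).
rewrite -[LHS](raddf_sum (@complex.Re R)) (tr_chan_out _ P_wf).
by rewrite tr_joint tr_rho_of tr_mu mulr1.
Qed.

Lemma runsS n : runs n.+1 = flatten [seq flatten [seq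
    [seq (rcons h.1 (z, o), 2^-1 *: chan_out P o (joint (rho z) h.2)) | o <- labels P]
    | z <- [:: false; true]] | h <- runs n].
Proof. by []. Qed.

Lemma sum_runsS (V : nmodType) n (G : seq (bool * outc) * 'M[C]_(mA * mB) -> V) :
  \sum_(h <- runs n.+1) G h = \sum_(h <- runs n)
    let S z := \sum_(o <- labels P)
      G (rcons h.1 (z, o), 2^-1 *: chan_out P o (joint (rho z) h.2)) in
    S false + S true.
Proof.
have seq2 (F : bool -> V) : \sum_(z <- [:: false; true]) F z = F false + F true.
  by rewrite big_cons big_seq1.
rewrite runsS big_flatten big_map; apply: eq_bigr => h _.
by rewrite big_flatten big_map seq2; congr (_ + _); rewrite big_map.
Qed.

Definition lvl (h : seq (bool * outc)) := foldl (fun c zo => next_level c zo.2) 0 h.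
Definition fails (h : seq (bool * outc)) := count (fun zo => zo.2.1 != zo.1) h.

Lemma next_le c o : (c <= m)%N -> (next_level c o <= m)%N.
Proof. by rewrite /next_level; case: ifP => // _; apply: leq_trans (leq_pred c). Qed.

Lemma lvl_le h : (lvl h <= m)%N.
Proof.
by rewrite /lvl; elim/last_ind: h => // h zo IH; rewrite foldl_rcons next_le.
Qed.

Lemma half_scale (x : C) : complex.Re (2^-1 * x) = 2^-1 * complex.Re x.
Proof.
have -> : (2^-1 : C) = (2^-1)%:C%C by rewrite fmorphV rmorph_nat.
by case: x => a b /=; rewrite mul0r subr0.
Qed.

(** The classical history determines the normalised memory state; the only other information is the
    probability [k] of the history. *)
Lemma runs_mu n h : h \in runs n ->
  exists2 k : R, 0 <= k & h.2 = k%:C%C *: mu (lvl h.1).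
Proof.
elim: n h => [|n IH] h.
  by rewrite /= inE => /eqP ->; exists 1; rewrite ?scale1r.
rewrite runsS => /flattenP[s /mapP[h' /IH [k k0 E] ->]].
move=> /flattenP[s' /mapP[z _ ->]] /mapP[o _ ->] /=.
exists (2^-1 * (k * weight (lvl h'.1) z o)).
  by rewrite !mulr_ge0 ?invr_ge0 ?ler0n ?weight_ge0 ?lvl_le.
rewrite E jointZr chan_outZ (out_weight _ _ (lvl_le _)) !scalerA /lvl foldl_rcons.
by congr (_ *: _); rewrite !rmorphM fmorphV rmorph_nat mulrA.
Qed.

Lemma runs_trace n : \sum_(h <- runs n) complex.Re (\tr h.2) = 1.
Proof.
elim: n => [|n IH]; first by rewrite big_seq1 tr_mu.
rewrite sum_runsS -[RHS]IH; apply: eq_bigr => h _.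
have half z : \sum_(o <- labels P)
    complex.Re (\tr (2^-1 *: chan_out P o (joint (rho z) h.2))) = 2^-1 * complex.Re (\tr h.2).
  under eq_bigr => o _ do rewrite mxtraceZ half_scale.
  by rewrite -mulr_sumr -(raddf_sum (@complex.Re R)) (tr_chan_out _ P_wf) tr_joint tr_rho_of mul1r.
apply: etrans (congr2 +%R (half false) (half true)) _.
by move: (complex.Re _) => x; lra.
Qed.

Lemma runs_ge0 n h : h \in runs n -> 0 <= complex.Re (\tr h.2).
Proof.
by case/runs_mu=> k k0 ->; rewrite mxtraceZ tr_mu mulr1.
Qed.

(** A Lyapunov function [w] for the chain. An unrefilled round at level 0 is charged the full
    penalty [t], whatever the guess, and stays at level 0 because [0.-1 = 0]. *)
Variables (t s : R) (w : nat -> R).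
Hypotheses (t_ge1 : 1 <= t) (w_ge1 : forall c, 1 <= w c).
Hypothesis drift : forall c, (c <= m)%N ->
  p * w m + (1 - p) * ((if c == 0%N then t else 1) * w c.-1) <= s * w c.

(** Wrong guesses have weight 0 in a refill or at positive level, so [t] survives only at level 0
    without refill, where it is bounded using [1 <= t]. *)
Lemma step_drift c z : (c <= m)%N ->
  \sum_(o <- labels P) t ^+ (o.1 != z) * w (next_level c o) * weight c z o <= s * w c.
Proof.
move=> cm; apply: le_trans (drift cm).
rewrite (bigID (fun o : outc => o.2 == 1%N)) /= -{1}(weight_refill z cm) -{1}(weight_consume z cm).
rewrite !mulr_suml; apply: lerD; apply: ler_sum => o o1.
  have [<-|ne] := eqVneq o.1 z; first by rewrite /next_level o1 expr0 mul1r mulrC.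
  by rewrite weight_wrong ?o1 ?orbT // mulr0 mul0r.
rewrite [leRHS]mulrC /next_level (negPf o1).
have w0 : 0 <= w c.-1 := le_trans ler01 (w_ge1 _).
case: (posnP c) => [c0|c0].
  rewrite ler_wpM2r ?weight_ge0 // ler_wpM2r //.
  by case: (_ != _); rewrite ?expr0 ?expr1.
have [_|ne] := eqVneq o.1 z; first by rewrite expr0.
by rewrite weight_wrong ?c0 ?cm // !mulr0.
Qed.

(** Up to the factor [s] per round, the potential is a supermartingale: conditioned on a history,
    [step_drift] applies for each value of the hidden bit. *)
Lemma potential_bound n :
  \sum_(h <- runs n) t ^+ fails h.1 * w (lvl h.1) * complex.Re (\tr h.2) <= s ^+ n * w 0.
Proof.
elim: n => [|n IH]; first by rewrite big_seq1 tr_mu /= !expr0 !mul1r mulr1.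
have s0 : 0 <= s.
  have := step_drift false (leq0n m); rewrite -(pmulr_lge0 s (lt_le_trans ltr01 (w_ge1 0))).
  apply: le_trans; apply: sumr_ge0 => o _.
  by rewrite !mulr_ge0 ?exprn_ge0 ?(le_trans ler01 t_ge1) ?(le_trans ler01 (w_ge1 _)) ?weight_ge0.
rewrite sum_runsS exprS -mulrA; apply: le_trans (ler_wpM2l s0 IH).
rewrite mulr_sumr big_seq [leRHS]big_seq; apply: ler_sum => h hr.
have [k k0 E] := runs_mu hr; have lm := lvl_le h.1.
have step z : \sum_(o <- labels P) t ^+ fails (rcons h.1 (z, o)) * w (lvl (rcons h.1 (z, o)))
    * complex.Re (\tr (2^-1 *: chan_out P o (joint (rho z) h.2)))
    <= 2^-1 * (t ^+ fails h.1 * k) * (s * w (lvl h.1)).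
  rewrite [leLHS](_ : _ = 2^-1 * (t ^+ fails h.1 * k) * \sum_(o <- labels P)
      t ^+ (o.1 != z) * w (next_level (lvl h.1) o) * weight (lvl h.1) z o).
    rewrite ler_wpM2l ?step_drift //.
    by rewrite !mulr_ge0 ?invr_ge0 ?ler0n ?exprn_ge0 ?(le_trans ler01 t_ge1).
  rewrite mulr_sumr; apply: eq_bigr => o _.
  rewrite E jointZr chan_outZ (out_weight _ _ lm) !mxtraceZ tr_mu mulr1 half_scale.
  by rewrite /fails /lvl -cats1 count_cat foldl_cat /= addn0 exprD; ring.
rewrite /=; apply: le_trans (lerD (step false) (step true)) _.
rewrite E mxtraceZ tr_mu mulr1 /=; set T := t ^+ _; lra.
Qed.

Lemma count_successes n h : h \in runs n -> (successes h.1 + fails h.1 = n)%N.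
Proof.
move/size_runs=> <-; rewrite /successes /fails -(count_predC (fun zo => zo.2.1 == zo.1) h.1).
by congr (_ + _)%N; apply: eq_count.
Qed.

Variables (theta : R) (K : nat).
Hypotheses (theta_ge0 : 0 <= theta) (theta_le1 : theta <= 1) (theta_t : t * theta ^+ K = 1).
Hypotheses (K_gt0 : (0 < K)%N) (s_theta : s * theta < 1) (s_ge0 : 0 <= s).

(* Markov's inequality for [t ^ fails], with [t = theta ^- K]. *)
Lemma prob_failure n :
  1 - w 0 * (s * theta) ^+ n <= prob_Sn_ge rho0 rho1 (mu 0) (fun=> P) n (1 - K%:R^-1).
Proof.
pose good (h : seq (bool * outc) * 'M[C]_(mA * mB)) :=
  (1 - K%:R^-1) * n%:R <= (successes h.1)%:R :> R.
have tot := runs_trace n; rewrite (bigID good) /= in tot.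
rewrite lerBlDr /prob_Sn_ge -[leLHS]tot lerD2l.
have -> : w 0 * (s * theta) ^+ n = theta ^+ n * (s ^+ n * w 0) by rewrite exprMn; ring.
apply: le_trans (ler_wpM2l (exprn_ge0 _ theta_ge0) (potential_bound n)).
rewrite mulr_sumr big_mkcond big_seq [leRHS]big_seq; apply: ler_sum => h hr.
have tr0 := runs_ge0 hr; have t0 := le_trans ler01 t_ge1.
have w0 := le_trans ler01 (w_ge1 (lvl h.1)).
case: ifP => [|_]; last by rewrite !mulr_ge0 ?exprn_ge0.
rewrite -ltNge => bad; rewrite !mulrA -[leLHS]mul1r ler_wpM2r //.
have Kf : (n <= K * fails h.1)%N.
  have KR : 0 < K%:R :> R by rewrite ltr0n.
  rewrite -(ler_nat R) natrM -ler_pdivrMl // mulrC; move: bad.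
  have /(congr1 (fun k => k%:R : R)) := count_successes hr; rewrite natrD => <-.
  by set a := (successes _)%:R; set b := (fails _)%:R; lra.
(* On a bad history, [n <= K * fails] and [theta <= 1] give [1 = (t * theta ^+ K) ^+ fails <= t ^+
   fails * theta ^+ n]. *)
rewrite -[leLHS]mulr1 ler_pM // -(expr1n R (fails h.1)) -theta_t exprMn -exprM.
by rewrite mulrC ler_wpM2r ?exprn_ge0 // ler_wiXn2l.
Qed.

Lemma achievable_rate : achievable rho0 rho1 (mu 0) (fun=> P) (1 - K%:R^-1).
Proof.
move=> eps e0 m0 _.
have [n [mn le]] := expr_small m0 (mulr_ge0 s_ge0 theta_ge0) s_theta (le_trans ler01 (w_ge1 0)) e0.
by exists n; split=> //; apply: le_trans (prob_failure n); lra.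
Qed.

End Statistics.


(** * Discrimination with an entangled memory *)

Section Digits.
Variables (C : numClosedFieldType) (d' m : nat).
Local Notation d := d'.+2.
Local Notation N := (d ^ m)%N.

Lemma sum_sign_orth (x y : 'I_d) :
  \sum_(s : {ffun 'I_d -> bool}) (-1) ^+ s x * (-1) ^+ s y
  = ((x == y) * #|{ffun 'I_d -> bool}|)%:R :> C.
Proof.
have [->|ne] := eqVneq x y.
  under eq_bigr => s _ do rewrite -expr2 sqrr_sign.
  by rewrite sumr_const mul1n.
(* Flipping the sign at [x] alone is a bijection that negates every summand, so the sum equals its
   opposite. *)
pose flip (s : {ffun 'I_d -> bool}) := [ffun z => s z (+) (z == x)].
have flipK : involutive flip by move=> s; apply/ffunP=> z; rewrite !ffunE addbK.
set S := \sum_s _; rewrite mul0n; suff: S = - S.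
  by move/eqP; rewrite -addr_eq0 -mulr2n mulrn_eq0 => /eqP.
rewrite {1}/S (reindex flip) /=; last by exists flip => s _; rewrite flipK.
rewrite -sumrN; apply: eq_bigr => s _; rewrite !ffunE eqxx eq_sym (negPf ne) addbF.
by rewrite signr_addb expr1 mulrN1 mulNr.
Qed.

Lemma digit_eq (u v : 'I_N) :
  (inZp u == inZp v :> 'I_d) && (u %/ d == v %/ d)%N = (u == v).
Proof.
apply/andP/eqP => [[/eqP/(congr1 val) /= mo /eqP di]|->]; last by rewrite !eqxx.
by apply: val_inj; rewrite /= (divn_eq u d) (divn_eq v d) mo di.
Qed.

Lemma sum_quotient (u v : 'I_N) :
  \sum_(r < N) (((r : nat) == (u %/ d)%N) && ((r : nat) == (v %/ d)%N))%:R
  = ((u %/ d)%N == (v %/ d)%N)%:R :> C.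
Proof.
have lt : (u %/ d < N)%N by apply: leq_ltn_trans (leq_div _ _) (ltn_ord u).
rewrite (bigD1 (Ordinal lt)) //= eqxx big1 ?addr0 // => r.
by rewrite -val_eqE /= => /negPf ->.
Qed.

Lemma sum_shift (x a b : 'I_d) :
  \sum_(z : 'I_d) ((a == x + z) && (b == x + z))%:R = (a == b)%:R :> C.
Proof.
rewrite (bigD1 (a - x)) //= [x + _]addrC subrK eqxx big1 ?addr0 => [|z ne].
  by rewrite eq_sym.
by case: eqP => // E; rewrite E addrAC subrr add0r eqxx in ne.
Qed.

(** The index is forced to be [r * d + z]. At [c = 0] only [u = 0] remains, with digit and quotient
    0, and [c.-1 = 0] gives the matching range [r < 1]. *)
Lemma count_digit c (z : 'I_d) (r : 'I_N) : (c <= m)%N ->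
  \sum_(u < N) ((u < d ^ c)%N && (inZp u == z) && ((r : nat) == (u %/ d)%N))%:R
  = (((0 < c)%N || (z == 0)) && (r < d ^ c.-1)%N)%:R :> C.
Proof.
case: c => [_|c cm] /=.
  have N0 : (0 < N)%N by rewrite expn_gt0.
  rewrite (bigD1 (Ordinal N0)) //= expn0 div0n ltnS leqn0 big1 ?addr0 => [|u].
    congr (nat_of_bool _)%:R; congr (_ && _).
    by rewrite -!val_eqE /= mod0n eq_sym.
  by rewrite -val_eqE /= ltnS leqn0 => /negPf ->.
have [rc|rc] := boolP (r < d ^ c)%N; last first.
  rewrite big1 // => u _; case: andP => // -[/andP[uc _] /eqP ru].
  by move: rc; rewrite ru ltn_divLR // mulnC -expnS uc.
have uc : (r * d + z < d ^ c.+1)%N.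
  rewrite expnS [in ltnRHS]mulnC (@leq_trans (r.+1 * d)%N) //; last by rewrite leq_pmul2r.
  by rewrite mulSnr ltn_add2l.
have uN : (r * d + z < N)%N by apply: leq_trans uc _; rewrite leq_exp2l.
rewrite (bigD1 (Ordinal uN)) //= uc divnMDl // divn_small // addn0 eqxx andbT.
have -> : inZp (r * d + z)%N = z by apply: val_inj; rewrite /= modnMDl modn_small.
rewrite eqxx big1 ?addr0 // => u; case: andP => // -[/andP[_ /eqP uz] /eqP ru] /eqP[].
by apply: val_inj; rewrite /= -uz ru /= -divn_eq.
Qed.
End Digits.


(** * The measurements of one round and their effect on the memory *)

Section Protocol.
Variables (R : realType) (d' m : nat).
Local Notation C := R[i].
Local Notation d := d'.+2.
Local Notation N := (d ^ m)%N.
Local Notation side := (side d' N).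
Local Notation D := #|{: side}|.
Implicit Types (r u v w : 'I_N) (z : bool).

(** Kraus operators from a party's input and memory share to the memory share alone: the input is
    absorbed. *)
Definition local_mx (f : 'I_N -> side -> 'I_N -> C) : 'M[C]_(N, D * N) :=
  \matrix_(r, k) f r (enum_val (mxtens_unindex k).1) (mxtens_unindex k).2.

Lemma local_mxE f r i u : local_mx f r (mxtens_index (i, u)) = f r (enum_val i) u.
Proof. by rewrite mxE mxtens_indexK. Qed.

Lemma local_complete (T : finType) (F : T -> 'I_N -> side -> 'I_N -> C) :
  (forall a b u v, \sum_t \sum_r (F t r a u)^* * F t r b v = ((a == b) && (u == v))%:R) ->
  \sum_t adj (local_mx (F t)) *m local_mx (F t) = 1%:M.
Proof.
move=> FE; apply/matrixP=> k l; case: (mxtens_indexP k) => i u; case: (mxtens_indexP l) => j v.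
rewrite summxE [RHS]mxE mxtens_eq -(inj_eq enum_val_inj) -FE.
apply: eq_bigr => t _; rewrite mxE; apply: eq_bigr => r _.
by rewrite adj_entry !local_mxE.
Qed.

(* The memory at level [c]: a maximally entangled vector of rank [d ^ c]. *)
Definition level c : 'M[C]_N := \matrix_(u, v) ((u == v) && (u < d ^ c)%N)%:R.

(** The entangled memory makes both parties read the same index [u], restricted to [u < d ^ c]. *)
Lemma local_act f g (Psi : 'M[C]_D) c r r' :
  (local_mx f *m (Psi *t level c) *m (local_mx g)^T) r r' =
  \sum_i \sum_j Psi i j *
    \sum_(u : 'I_N) (u < d ^ c)%N%:R * (f r (enum_val i) u * g r' (enum_val j) u).
Proof.
rewrite mxE sum_tens [RHS]exchange_big /=; apply: eq_bigr => j _.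
rewrite [LHS](eq_bigr (fun u : 'I_N => \sum_i Psi i j * ((u < d ^ c)%N%:R *
  (f r (enum_val i) u * g r' (enum_val j) u)))) => [|v _].
  by rewrite exchange_big /=; apply: eq_bigr => i _; rewrite mulr_sumr.
rewrite [X in _ * X]mxE local_mxE mxE sum_tens mulr_suml; apply: eq_bigr => i _.
rewrite (bigD1 v) //= local_mxE tensmxE [level _ _ _]mxE eqxx big1 ?addr0 => [|u ne].
  by rewrite /=; ring.
by rewrite tensmxE [level _ _ _]mxE (negPf ne) !mulr0.
Qed.

Definition alice_outcome : finType := ('I_d * {ffun 'I_d -> bool} + bool * 'I_N)%type.
Definition bob_outcome : finType := ('I_d * 'I_d * bool + bool * 'I_N)%type.

(* The memory index is written in base [d]; a round consumes the lowest digit,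
   which Alice compares with the hiding symbol, and keeps the quotient. *)
Definition hit (a x : 'I_d) u r : bool := (inZp u == x + a) && ((r : nat) == (u %/ d)%N).

(** Reads the flag bit [k.1], moves the fresh index [r] into the memory, and measures the old memory
    index [k.2], which is thereby discarded. *)
Definition pick_coef (k : bool * 'I_N) r (a : side) u : C :=
  ((a == inr (k.1, r)) && (u == k.2))%:R.

Definition sign_norm : C := sqrtC (#|{ffun 'I_d -> bool}|%:R^-1).

(* Random signs [s] replace the phases of the usual Bell measurement: averaging
   over them kills the off-diagonal terms, by [sum_sign_orth]. *)
Definition alice_coef (i : alice_outcome) r (a : side) u : C :=
  match i, a with
  | inl (a0, s), inl x => sign_norm * (-1) ^+ s x * (hit a0 x u r)%:R
  | inl _, inr _ => 0
  | inr k, _ => pick_coef k r a u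
  end.

(** Bob's half of the teleportation: his memory digit [x0 + a0] stands for Alice's symbol [x0], and
    the sign cancels hers. *)
Definition bob_term (a0 : 'I_d) (s : {ffun 'I_d -> bool})
    (x0 y0 : 'I_d) r (y : 'I_d) u : C :=
  (-1) ^+ s x0 * ((y == y0) && hit a0 x0 u r)%:R.

(* Indexing by ordered pairs makes the family complete with weight [1/2], the
   diagonal pairs [x0 = y0] included. *)
Definition bob_coef (i : alice_outcome) (j : bob_outcome) r (b : side) u : C :=
  let k : 'I_d * {ffun 'I_d -> bool} := if i is inl k then k else (0, [ffun=> false]) in
  match j, b with
  | inl (x0, y0, t), inl y =>
      2^-1 * (bob_term k.1 k.2 x0 y0 r y u + (-1) ^+ t * bob_term k.1 k.2 y0 x0 r y u)
  | inl _, inr _ => 0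
  | inr k', _ => pick_coef k' r b u
  end.

(** Outcomes with one party flagged and the other not have amplitude 0 on the hiding and on the
    refill vectors; their label is a default. *)
Definition label (i : alice_outcome) (j : bob_outcome) : outc :=
  match i, j with
  | inl _, inl (_, _, t) => (t, 0%N)
  | inr k, inr k' => (k.1 (+) k'.1, 1%N)
  | _, _ => (false, 0%N)
  end.

Lemma pick_complete (a b : side) u v :
  \sum_k \sum_r (pick_coef k r a u)^* * pick_coef k r b v =
  (if a is inr _ then (a == b) && (u == v) else false)%:R.
Proof.
case: a => [x|[b1 w]].
  by rewrite big1 // => k _; rewrite big1 // => r _; rewrite /pick_coef conjC0 mul0r.
rewrite (bigD1 (b1, u)) //= (bigD1 w) //= /pick_coef !eqxx conjC1 mul1r !big1 ?addr0.
- by rewrite eq_sym (eq_sym v).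
- move=> [b2 u2] ne; rewrite big1 // => r _ /=; case: andP => [[/eqP[Eb _] /eqP Eu]|_].
    by rewrite Eb Eu eqxx in ne.
  by rewrite conjC0 mul0r.
- move=> r ne; case: andP => [[/eqP[E] _]|_]; first by rewrite E eqxx in ne.
  by rewrite conjC0 mul0r.
Qed.

(** For a given symbol [x], the shift [a] fixes the lowest digit and [r] the quotient, and together
    they determine the index. *)
Lemma sum_hit (x : 'I_d) u v :
  \sum_a \sum_r (hit a x u r && hit a x v r)%:R = (u == v)%:R :> C.
Proof.
rewrite -digit_eq -mulnb natrM -(sum_shift _ x) -sum_quotient mulr_suml.
apply: eq_bigr => a _; rewrite mulr_sumr; apply: eq_bigr => r _.
by rewrite -natrM mulnb /hit andbACA.
Qed.

Lemma hitC a x u r : hit a x u r = hit x a u r.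
Proof. by rewrite /hit addrC. Qed.

Lemma conj_sign_nat (n b : nat) : ((-1) ^+ n * b%:R : C)^* = (-1) ^+ n * b%:R.
Proof. by rewrite rmorphM rmorph_nat rmorphXn rmorphN1. Qed.

Lemma conj_half_sum (t : nat) (a b : C) : a^* = a -> b^* = b ->
  (2^-1 * (a + (-1) ^+ t * b))^* = 2^-1 * (a + (-1) ^+ t * b).
Proof.
by move=> ca cb; rewrite rmorphM rmorphD rmorphM fmorphV rmorph_nat rmorphXn rmorphN1 /= ca cb.
Qed.

Lemma sign_norm2 : sign_norm^* * sign_norm = #|{ffun 'I_d -> bool}|%:R^-1.
Proof. by rewrite mulrC -normCK ger0_norm ?sqrtCK // sqrtC_ge0 invr_ge0 ler0n. Qed.

(** On the hiding part the random signs force equal symbols, after which [sum_hit] forces equal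
    memory indices; the flagged part is [pick_complete]. *)
Lemma alice_complete :
  \sum_i adj (local_mx (alice_coef i)) *m local_mx (alice_coef i) = 1%:M.
Proof.
apply: local_complete => a b u v; rewrite big_sumType /= pick_complete.
case: a => [x|w]; last first.
  by rewrite big1 ?add0r // => -[a0 s] _; rewrite big1 // => r _; rewrite conjC0 mul0r.
rewrite addr0; case: b => [y|w]; last first.
  by rewrite big1 // => -[a0 s] _; rewrite big1 // => r _; rewrite mulr0.
pose n : C := #|{ffun 'I_d -> bool}|%:R.
have n0 : n != 0.
  by rewrite pnatr_eq0 -lt0n; apply/card_gt0P; exists [ffun=> false].
have termE a0 (s : {ffun 'I_d -> bool}) r :
    (sign_norm * (-1) ^+ s x * (hit a0 x u r)%:R)^* *
    (sign_norm * (-1) ^+ s y * (hit a0 y v r)%:R) =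
    n^-1 * ((-1) ^+ s x * (-1) ^+ s y) * (hit a0 x u r && hit a0 y v r)%:R.
  rewrite -(mulrA sign_norm ((-1) ^+ s x)) rmorphM /= conj_sign_nat -mulnb natrM -sign_norm2.
  by ring.
transitivity (\sum_(a0 : 'I_d) \sum_(s : {ffun 'I_d -> bool}) \sum_r
    (sign_norm * (-1) ^+ s x * (hit a0 x u r)%:R)^* *
    (sign_norm * (-1) ^+ s y * (hit a0 y v r)%:R)).
  by rewrite [RHS]pair_bigA; apply: eq_bigr => -[a0 s] _.
rewrite (eq_bigr (fun a0 => (x == y)%:R * \sum_r (hit a0 x u r && hit a0 y v r)%:R)) => [|a0 _].
  rewrite -mulr_sumr -[inl x == inl y]/(x == y).
  have [<-|_] := eqVneq x y; last by rewrite mul0r.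
  by rewrite sum_hit mul1r.
rewrite (eq_bigr (fun s : {ffun 'I_d -> bool} => n^-1 * ((-1) ^+ s x * (-1) ^+ s y) *
   \sum_r (hit a0 x u r && hit a0 y v r)%:R)) => [|s _]; last first.
  by rewrite mulr_sumr; apply: eq_bigr => r _; apply: termE.
rewrite -mulr_suml -mulr_sumr sum_sign_orth natrM -/n; congr (_ * _).
by rewrite mulrCA mulVf ?mulr1.
Qed.

Lemma bob_complete i :
  \sum_j adj (local_mx (bob_coef i j)) *m local_mx (bob_coef i j) = 1%:M.
Proof.
set k : 'I_d * {ffun 'I_d -> bool} := if i is inl k then k else (0, [ffun=> false]).
apply: local_complete => a b u v; rewrite big_sumType /= pick_complete -/k.
case: a => [y|w]; last first.
  by rewrite big1 ?add0r // => -[[x0 y0] t] _; rewrite big1 // => r _; rewrite conjC0 mul0r.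
rewrite addr0; case: b => [y'|w]; last first.
  by rewrite big1 // => -[[x0 y0] t] _; rewrite big1 // => r _; rewrite mulr0.
pose V x0 y0 r := bob_term k.1 k.2 x0 y0 r y u.
pose V' x0 y0 r := bob_term k.1 k.2 x0 y0 r y' v.
transitivity (\sum_(xy : 'I_d * 'I_d) \sum_(t : bool) \sum_r
    (2^-1 * (V xy.1 xy.2 r + (-1) ^+ t * V xy.2 xy.1 r))^* *
    (2^-1 * (V' xy.1 xy.2 r + (-1) ^+ t * V' xy.2 xy.1 r))).
  by rewrite [RHS]pair_bigA; apply: eq_bigr => -[[x0 y0] t] _.
pose W x0 y0 := \sum_r V x0 y0 r * V' x0 y0 r.
have cV x0 y0 r : (V x0 y0 r)^* = V x0 y0 r by exact: conj_sign_nat.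
(* Summing over the sign [t] cancels the cross terms; the two halves that remain have equal sums
   over ordered pairs. *)
have step xy : \sum_(t : bool) \sum_r (2^-1 * (V xy.1 xy.2 r + (-1) ^+ t * V xy.2 xy.1 r))^* *
   (2^-1 * (V' xy.1 xy.2 r + (-1) ^+ t * V' xy.2 xy.1 r)) =
   2^-1 * (W xy.1 xy.2 + W xy.2 xy.1).
  rewrite big_bool /W /= -!big_split /= mulr_sumr; apply: eq_bigr => r _.
  rewrite !conj_half_sum ?cV // expr0 expr1.
  by move: (V _ _ _) (V _ _ _) (V' _ _ _) (V' _ _ _) => a1 a2 a3 a4; field.
rewrite (eq_bigr _ (fun xy _ => step xy)) -mulr_sumr big_split /=.
have swapW : \sum_(xy : 'I_d * 'I_d) W xy.2 xy.1 = \sum_(xy : 'I_d * 'I_d) W xy.1 xy.2.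
  rewrite -(pair_bigA _ (fun x y => W y x)) exchange_big /=.
  by rewrite -(pair_bigA _ (fun x y => W x y)).
rewrite swapW.
have halves (S : C) : 2^-1 * (S + S) = S by field.
rewrite halves.
rewrite -(pair_bigA _ (fun x y => W x y)) /= exchange_big /= -[inl y == inl y']/(y == y').
rewrite (bigD1 y) //= [X in _ + X = _]big1 ?addr0 => [|y0 ne]; last first.
  rewrite big1 // => x0 _; rewrite /W big1 // => r _.
  by rewrite /V /bob_term eq_sym (negPf ne) mulr0 mul0r.
rewrite -mulnb natrM -(sum_hit k.1) mulr_sumr; apply: eq_bigr => x0 _.
rewrite mulr_sumr; apply: eq_bigr => r _.
rewrite /V /V' /bob_term eqxx (eq_sym y') mulrACA -expr2 sqrr_sign mul1r -!natrM !mulnb /=.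
by rewrite !(hitC _ k.1) andbCA.
Qed.

Lemma sum_delta (a b : 'I_D) (G : 'I_D -> 'I_D -> C) :
  \sum_i \sum_j delta_mx a b i j * G i j = G a b.
Proof.
rewrite (bigD1 a) //= (bigD1 b) //= mxE !eqxx mul1r !big1 ?addr0 // => [i /negPf ne|j /negPf ne].
  by rewrite big1 // => j _; rewrite mxE ne mul0r.
by rewrite mxE ne andbF mul0r.
Qed.

Lemma hide_act f g z (x y : 'I_d) c r r' :
  (local_mx f *m (hide_vec R N z x y *t level c) *m (local_mx g)^T) r r' =
  (\sum_(u : 'I_N) (u < d ^ c)%N%:R * (f r (inl x) u * g r' (inl y) u)) +
  (-1) ^+ z * (\sum_(u : 'I_N) (u < d ^ c)%N%:R * (f r (inl y) u * g r' (inl x) u)).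
Proof.
rewrite local_act; pose G (i j : 'I_D) := \sum_(u : 'I_N) (u < d ^ c)%N%:R *
  (f r (enum_val i) u * g r' (enum_val j) u).
pose e (a : 'I_d) := enum_rank (inl a : side).
have -> : \sum_i \sum_j hide_vec R N z x y i j * G i j =
    \sum_i \sum_j delta_mx (e x) (e y) i j * G i j +
    (-1) ^+ z * \sum_i \sum_j delta_mx (e y) (e x) i j * G i j.
  rewrite mulr_sumr -big_split; apply: eq_bigr => i _ /=.
  rewrite mulr_sumr -big_split; apply: eq_bigr => j _ /=.
  by rewrite 3!mxE mulrDl mulrA.
by rewrite !sum_delta /G /e !enum_rankK.
Qed.

(** Teleportation in this encoding: both digit tests read the same [u], so they agree only for
    [x = x0], and the two signs multiply to 1. *)
Lemma hit_term a0 (s : {ffun 'I_d -> bool}) (x y x0 y0 : 'I_d) c u r r' :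
  (u < d ^ c)%N%:R * ((-1) ^+ s x * (hit a0 x u r)%:R * bob_term a0 s x0 y0 r' y u) =
  ((x == x0) && (y == y0))%:R * (r == r')%:R *
    ((u < d ^ c)%N && (inZp u == x + a0) && ((r : nat) == (u %/ d)%N))%:R.
Proof.
rewrite /bob_term /hit.
have [->|nx] := eqVneq x x0; last first.
  have : ~~ ((inZp u == x + a0) && (inZp u == x0 + a0)).
    by apply/negP => /andP[/eqP ->]; rewrite (inj_eq (addIr a0)) (negPf nx).
  by case: (inZp u == x + a0); case: (inZp u == x0 + a0) => //= _; rewrite ?andbF !(mulr0, mul0r).
have [_|_] := eqVneq y y0; last by rewrite !(mulr0, mul0r).
case: (u < d ^ c)%N; rewrite ?(mul0r, mulr0) //= !mul1r.
case: (inZp u == _); rewrite ?(mul0r, mulr0) //=.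
case: (eqVneq (r : nat)) => [ru|]; rewrite ?(mul0r, mulr0) //=.
rewrite mulr1 mulrA -expr2 sqrr_sign mul1r mulr1.
by rewrite -ru -val_eqE eq_sym.
Qed.

Lemma hide_hit i j z (x y : 'I_d) c : (c <= m)%N -> exists k,
  local_mx (alice_coef i) *m (hide_vec R N z x y *t level c) *m (local_mx (bob_coef i j))^T
    = k *: level (next_level m c (label i j)) /\
  (((label i j).2 == 1%N) || (0 < c)%N && ((label i j).1 != z) -> k = 0).
Proof.
move=> cm.
have zero (f g : 'I_N -> side -> 'I_N -> C) :
    (forall r u, f r (inl x) u = 0 /\ f r (inl y) u = 0) \/
    (forall r u, g r (inl x) u = 0 /\ g r (inl y) u = 0) ->
    local_mx f *m (hide_vec R N z x y *t level c) *m (local_mx g)^T = 0.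
  move=> fg; apply/matrixP=> r r'; rewrite hide_act !mxE !big1 ?mulr0 ?addr0 // => u _.
    by case: fg => [f0|g0]; [rewrite (f0 r u).2 | rewrite (g0 r' u).1]; rewrite ?(mul0r, mulr0).
  by case: fg => [f0|g0]; [rewrite (f0 r u).1 | rewrite (g0 r' u).2]; rewrite ?(mul0r, mulr0).
case: i => [[a0 s]|k]; last first.
  by exists 0; rewrite scale0r zero //; left.
case: j => [[[x0 y0] t]|k]; last first.
  by exists 0; rewrite scale0r zero //; right.
(* [eta] tells whether the digit [x' + a0] occurs in the memory: any digit at positive level, only 0
   at level 0. [T] is the overlap with Bob's symmetrised pair. *)
pose eta (x' : 'I_d) : C := ((0 < c)%N || (x' + a0 == 0))%:R.
pose T (x' y' : 'I_d) : C := ((x' == x0) && (y' == y0))%:R +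
  (-1) ^+ t * ((x' == y0) && (y' == x0))%:R.
exists (2^-1 * sign_norm * (T x y * eta x + (-1) ^+ z * (T y x * eta y))); split.
  have sumE x' y' r r' : \sum_(u : 'I_N) (u < d ^ c)%N%:R *
      (alice_coef (inl (a0, s)) r (inl x') u *
       bob_coef (inl (a0, s)) (inl (x0, y0, t)) r' (inl y') u) =
      2^-1 * sign_norm * (T x' y' * eta x') * level c.-1 r r'.
    transitivity (\sum_(u : 'I_N) 2^-1 * sign_norm * T x' y' * (r == r')%:R *
        ((u < d ^ c)%N && (inZp u == x' + a0) && ((r : nat) == (u %/ d)%N))%:R).
      apply: eq_bigr => u _ /=.
      have h1 := hit_term a0 s x' y' x0 y0 c u r r'.
      have h2 := hit_term a0 s x' y' y0 x0 c u r r'.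
      transitivity (2^-1 * sign_norm * (
        ((u < d ^ c)%N%:R *
          ((-1) ^+ s x' * (hit a0 x' u r)%:R * bob_term a0 s x0 y0 r' y' u)) +
        (-1) ^+ t * ((u < d ^ c)%N%:R *
          ((-1) ^+ s x' * (hit a0 x' u r)%:R * bob_term a0 s y0 x0 r' y' u)))).
        by ring.
      by rewrite h1 h2 /T; ring.
    rewrite -mulr_sumr count_digit // mxE -!mulnb !natrM /eta.
    by ring.
  apply/matrixP=> r r'; rewrite hide_act !sumE [RHS]mxE /next_level /=; ring.
rewrite /= => /andP[c0 tz].
have eta1 x' : eta x' = 1 by rewrite /eta c0.
(* With [eta = 1] the amplitude is proportional to [1 + (-1) ^+ (z (+) t)], which vanishes on a
   wrong guess. At level 0 the two [eta] may differ and the cancellation fails. *)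
have Tyx : T y x = (-1) ^+ t * T x y.
  rewrite /T andbC mulrDr mulrA -expr2 sqrr_sign mul1r addrC; congr (_ + _).
  by rewrite andbC.
rewrite !eta1 !mulr1 Tyx mulrA -signr_addb.
have -> : z (+) t by case: (z) (t) tz => -[].
by rewrite expr1 mulN1r subrr mulr0.
Qed.

Lemma refill_hit i j z c : exists k,
  local_mx (alice_coef i) *m (refill_vec R d' N z *t level c) *m (local_mx (bob_coef i j))^T
    = k *: level (next_level m c (label i j)) /\
  (((label i j).2 != 1%N) || ((label i j).1 != z) -> k = 0).
Proof.
have actE f g r r' : (local_mx f *m (refill_vec R d' N z *t level c) *m (local_mx g)^T) r r' =
    \sum_a \sum_b refill_coef R z a b * \sum_(u : 'I_N) (u < d ^ c)%N%:R * (f r a u * g r' b u).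
  rewrite local_act -[RHS](sum_enum_val (fun a => \sum_b _)) /=; apply: eq_bigr => i0 _.
  rewrite -[RHS](sum_enum_val (fun b => refill_coef R z _ b * _)) /=.
  by apply: eq_bigr => j0 _; rewrite mxE.
have zero (f g : 'I_N -> side -> 'I_N -> C) :
    (forall r k u, f r (inr k) u = 0) \/ (forall r k u, g r (inr k) u = 0) ->
    local_mx f *m (refill_vec R d' N z *t level c) *m (local_mx g)^T = 0.
  move=> fg; apply/matrixP=> r r'; rewrite actE mxE big1 // => a _; rewrite big1 // => b _.
  case: a => [x|k]; first by rewrite mul0r.
  case: b => [y|k']; first by rewrite /= [X in X * _](_ : _ = 0) ?mul0r //; case: (k).
  rewrite big1 ?mulr0 // => u _.
  by case: fg => [f0|g0]; rewrite ?f0 ?g0 ?(mul0r, mulr0).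
case: i => [[a0 s]|k].
  by exists 0; rewrite scale0r zero //; left.
case: j => [[[x0 y0] t]|k'].
  by exists 0; rewrite scale0r zero //; right.
exists ((k.1 (+) k'.1 == z)%:R * (-1) ^+ (k.1 && z) *
  \sum_(u : 'I_N) (u < d ^ c)%N%:R * ((u == k.2)%:R * (u == k'.2)%:R)); split; last first.
  by move=> /= /negPf ->; rewrite !mul0r.
apply/matrixP=> r r'; rewrite actE (bigD1 (inr (k.1, r))) //= (bigD1 (inr (k'.1, r'))) //=.
rewrite [X in _ + X + _]big1 ?addr0 => [|b /negPf nb]; last first.
  by rewrite big1 ?mulr0 // => u _; rewrite /pick_coef nb /= !mulr0.
rewrite [X in _ + X]big1 ?addr0 => [|a /negPf na]; last first.
  rewrite big1 // => b _; rewrite big1 ?mulr0 // => u _.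
  by rewrite /pick_coef na /= mul0r mulr0.
rewrite /pick_coef !eqxx /= [RHS]mxE [level _ _ _]mxE /next_level /= ltn_ord andbT.
by rewrite -mulnb natrM; ring.
Qed.

Definition discriminator : proto R outc N N (D * N) (D * N) :=
  oneway (fun i => local_mx (alice_coef i)) (fun i j => local_mx (bob_coef i j)) label.

Lemma discriminator_wf : proto_wf discriminator.
Proof. exact: oneway_wf alice_complete bob_complete. Qed.

Definition memory c : 'M[C]_(N * N) :=
  (\tr (vproj (level c)))^-1 *: vproj (level c).

Lemma tr_level_gt0 c : 0 < \tr (vproj (level c)).
Proof.
have N0 : (0 < N)%N by rewrite expn_gt0.
rewrite tr_vproj (bigD1 (Ordinal N0)) //= (bigD1 (Ordinal N0)) //= -addrA mxE eqxx expn_gt0 /=.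
rewrite normr1 expr1n ltr_wpDr // addr_ge0 ?sumr_ge0 // => i _; rewrite ?exprn_ge0 //.
by rewrite sumr_ge0 // => j _; rewrite exprn_ge0.
Qed.

Lemma tr_memory c : \tr (memory c) = 1.
Proof. by rewrite mxtraceZ mulVf // gt_eqF // tr_level_gt0. Qed.

Lemma memory_state c : is_state (memory c).
Proof.
split; last exact: tr_memory.
by apply: psdZ (psd_vproj _); rewrite invr_ge0 ltW // tr_level_gt0.
Qed.

Lemma vproj_level c : vproj (level c) = \tr (vproj (level c)) *: memory c.
Proof. by rewrite scalerA divff ?scale1r // gt_eqF // tr_level_gt0. Qed.

Section Outcome.
Variables (c : nat) (o : outc).
Local Notation out X := (chan_out discriminator o (joint X (memory c))).

Lemma outD X Y : out (X + Y) = out X + out Y.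
Proof. by rewrite jointDl chan_outD. Qed.

Lemma outZ (k : C) X : out (k *: X) = k *: out X.
Proof. by rewrite jointZl chan_outZ. Qed.

Lemma out0 : out 0 = 0.
Proof. by rewrite -(scale0r 0) outZ scale0r. Qed.

Lemma out_mix (k k' : C) X Y : out (k *: X + k' *: Y) = k *: out X + k' *: out Y.
Proof. exact: chan_out_joint_mix. Qed.

(* [X] leads to the memory state of the next level, and the outcome is
   impossible when [Q] holds. *)
Definition resolved (Q : bool) X : Prop :=
  (exists2 k, 0 <= k & out X = k *: memory (next_level m c o)) /\ (Q -> out X = 0).

Lemma resolvedD Q X Y : resolved Q X -> resolved Q Y -> resolved Q (X + Y).
Proof.
move=> [[k k0 E] Z] [[k' k'0 E'] Z']; split; last by move=> q; rewrite outD Z // Z' // addr0.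
by exists (k + k'); rewrite ?addr_ge0 // outD E E' scalerDl.
Qed.

Lemma resolved0 Q : resolved Q 0.
Proof. by split=> [|_]; [exists 0; rewrite ?scale0r|]; rewrite ?out0. Qed.

Lemma resolvedZ Q (k : C) X : 0 <= k -> resolved Q X -> resolved Q (k *: X).
Proof.
move=> k0 [[k' k'0 E] Z]; split; last by move=> q; rewrite outZ Z // scaler0.
by exists (k * k'); rewrite ?mulr_ge0 // outZ E scalerA.
Qed.

Lemma out_vproj (Psi : 'M[C]_D) :
  out (vproj Psi) = (\tr (vproj (level c)))^-1 *: \sum_i \sum_(j | label i j == o)
    vproj (local_mx (alice_coef i) *m (Psi *t level c) *m (local_mx (bob_coef i j))^T).
Proof.
rewrite /memory jointZr chan_outZ joint_vproj chan_out_oneway; congr (_ *: _).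
by apply: eq_bigr => i _; apply: eq_bigr => j _; rewrite tens_vproj.
Qed.

(** Amplitudes enter through [|k|^2], so different outcome pairs with the same label add up as
    nonnegative multiples of one memory state. *)
Lemma resolved_vproj (Q : outc -> bool) (Psi : 'M[C]_D) :
  (forall i j, exists k,
    local_mx (alice_coef i) *m (Psi *t level c) *m (local_mx (bob_coef i j))^T
      = k *: level (next_level m c (label i j)) /\ (Q (label i j) -> k = 0)) ->
  resolved (Q o) (vproj Psi).
Proof.
move=> hits; rewrite /resolved out_vproj.
set S := \sum_i _.
suff [[k k0 E] Z] : (exists2 k, 0 <= k & S = k *: memory (next_level m c o)) /\ (Q o -> S = 0).
  split; last by move=> q; rewrite Z ?scaler0.
  rewrite E scalerA; eexists; last by [].
  by rewrite mulr_ge0 // invr_ge0 ltW ?tr_level_gt0.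
have term i j : label i j == o -> exists2 k, 0 <= k &
    vproj (local_mx (alice_coef i) *m (Psi *t level c) *m (local_mx (bob_coef i j))^T)
    = k *: memory (next_level m c o) /\ (Q o -> k = 0).
  move=> /eqP lo; have [k [-> kQ]] := hits i j; rewrite lo in kQ *.
  exists (`|k| ^+ 2 * \tr (vproj (level (next_level m c o)))).
    by rewrite mulr_ge0 ?exprn_ge0 // ltW ?tr_level_gt0.
  split; first by rewrite vprojZ [in LHS]vproj_level scalerA.
  by move=> /kQ ->; rewrite normr0 expr0n mul0r.
rewrite /S; split; last first.
  move=> q; rewrite big1 // => i _; rewrite big1 // => j /term[k _ [-> kQ]].
  by rewrite kQ ?scale0r.
pose ray X := exists2 k, 0 <= k & X = k *: memory (next_level m c o).
have rayD X Y : ray X -> ray Y -> ray (X + Y).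
  by move=> [k k0 ->] [k' k'0 ->]; exists (k + k'); rewrite ?addr_ge0 ?scalerDl.
have ray0 : ray 0 by exists 0; rewrite ?scale0r.
apply: (big_ind ray) => // i _; apply: (big_ind ray) => // j /term[k k0 [E _]].
by exists k.
Qed.

Lemma resolved_hide z : (c <= m)%N ->
  resolved ((o.2 == 1%N) || (0 < c)%N && (o.1 != z)) (hide_state R d' N z).
Proof.
move=> cm; set Q := (X in resolved X); apply: resolvedZ; first exact: kappa_ge0.
apply: (big_ind (resolved Q)); [exact: resolved0 | exact: resolvedD | move=> x _].
apply: (big_ind (resolved Q)); [exact: resolved0 | exact: resolvedD | move=> y _].
apply: (@resolved_vproj (fun o => (o.2 == 1%N) || (0 < c)%N && (o.1 != z))) => i j.
exact: hide_hit.
Qed.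

Lemma resolved_refill z : resolved ((o.2 != 1%N) || (o.1 != z)) (refill_state R d' N z).
Proof.
apply: resolvedZ; first exact: invN_ge0.
apply: (@resolved_vproj (fun o => (o.2 != 1%N) || (o.1 != z))) => i j.
exact: refill_hit.
Qed.
End Outcome.

Variable p : R.
Hypotheses (p_ge0 : 0 <= p) (p_le1 : p <= 1).
Local Notation rho := (rho d' N p).
Local Notation out c z o := (chan_out discriminator o (joint (rho z) (memory c))).

Lemma out_rho c z o : out c z o =
  (1 - p)%:C%C *: chan_out discriminator o (joint (hide_state R d' N z) (memory c)) +
  p%:C%C *: chan_out discriminator o (joint (refill_state R d' N z) (memory c)).
Proof.
exact: out_mix.
Qed.

Lemma discriminator_ray c z o : (c <= m)%N ->
  exists2 k, 0 <= k & out c z o = k *: memory (next_level m c o).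
Proof.
move=> cm; rewrite out_rho.
have [[k k0 ->] _] := resolved_hide o z cm; have [[k' k'0 ->] _] := resolved_refill c o z.
exists ((1 - p)%:C%C * k + p%:C%C * k'); last by rewrite scalerDl !scalerA.
by apply: addr_ge0; apply: mulr_ge0 => //; [exact: q_geC | exact: p_geC].
Qed.

Lemma discriminator_correct c z (o : outc) : (c <= m)%N -> (0 < c)%N || (o.2 == 1%N) ->
  o.1 != z -> out c z o = 0.
Proof.
move=> cm co oz; rewrite out_rho.
have [_ ->] := resolved_hide o z cm; last first.
  by rewrite oz andbT orbC.
by have [_ ->] := resolved_refill c o z; rewrite ?oz ?orbT // !scaler0 addr0.
Qed.

(** The refill part of the state always produces label 1 and the hiding part never does, so the
    total weight is the mixing weight [p]. *)
Lemma discriminator_refill c z : (c <= m)%N ->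
  complex.Re (\tr (\sum_(o <- labels discriminator | o.2 == 1%N) out c z o)) = p.
Proof.
move=> cm.
have tr1 : \sum_(o <- labels discriminator) \tr (chan_out discriminator o
    (joint (refill_state R d' N z) (memory c))) = 1.
  rewrite (tr_chan_out _ discriminator_wf) tr_joint tr_memory mulr1 tr_refill_state //.
  by rewrite expn_gt0.
rewrite [\tr _]raddf_sum /=.
have -> : \sum_(o <- labels discriminator | o.2 == 1%N) \tr (out c z o) = p%:C%C.
  rewrite -[RHS]mulr1 -tr1 mulr_sumr big_mkcond /=; apply: eq_bigr => o _.
  rewrite out_rho; case: ifP => o1.
    by have [_ ->] := resolved_hide o z cm; rewrite ?o1 // scaler0 add0r mxtraceZ.
  by have [_ ->] := resolved_refill c o z; rewrite ?o1 // mxtrace0 mulr0.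
by [].
Qed.
End Protocol.


(** * Choice of parameters and conclusion *)

Lemma expr1B_ge (R : realType) (x : R) n : 0 <= x -> x <= 1 -> 1 - n%:R * x <= (1 - x) ^+ n.
Proof.
move=> x0 x1; elim: n => [|n IH]; first by rewrite mul0r subr0.
rewrite exprS; have y0 : 0 <= 1 - x by rewrite subr_ge0.
apply: le_trans (ler_wpM2l y0 IH); rewrite -natr1.
by have := mulr_ge0 (ler0n R n) (sqr_ge0 x); rewrite expr2; lra.
Qed.

Lemma memory_rate (R : realType) d' (p : R) K : 0 < p -> p < 1 -> (0 < K)%N ->
  exists m, achievable (rho d' (d'.+2 ^ m) p false) (rho d' (d'.+2 ^ m) p true)
    (memory R d' m 0) (fun=> discriminator R d' m) (1 - K%:R^-1).
Proof.
move=> p0 p1 K0; have KR : 1 <= K%:R :> R by rewrite (ler_nat _ 1).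
pose q := 1 - p; have q0 : 0 <= q by rewrite /q; lra.
have q1 : q < 1 by rewrite /q; lra.
have e0 : 0 < (2%:R * K%:R)^-1 :> R by rewrite invr_gt0 mulr_gt0 ?ltr0n.
(* With [q ^+ m <= 1 / (2 * K)], the growth [p * q ^+ m] stays below [eta]. *)
have [m [_ qm]] := expr_small 0 q0 q1 ler01 e0; rewrite mul1r in qm.
exists m; pose eta := p * (2%:R * K%:R)^-1; pose theta := 1 - eta.
have Keta : K%:R * eta = p / 2%:R by rewrite /eta; field; rewrite pnatr_eq0 -lt0n.
have eta0 : 0 < eta by rewrite mulr_gt0.
have eta1 : eta <= 1 by nra.
have thetaK : 1 - p / 2%:R <= theta ^+ K by rewrite -Keta expr1B_ge // ltW.
have theta0 : 0 <= theta by rewrite subr_ge0.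
have theta1 : theta <= 1 by rewrite /theta; lra.
have thetaK0 : 0 < theta ^+ K by apply: lt_le_trans thetaK; lra.
have thetaK1 : theta ^+ K <= 1 by rewrite exprn_ile1.
have qm0 : 0 <= q ^+ m by rewrite exprn_ge0.
pose t := (theta ^+ K)^-1; pose s := 1 + p * q ^+ m.
pose w (c : nat) : R := 1 + q ^+ c.
have N0 : (0 < d'.+2 ^ m)%N by rewrite expn_gt0.
have p_ge0 := ltW p0; have p_le1 := ltW p1.
have t1 : 1 <= t by rewrite /t invf_ge1.
have w1 c : 1 <= w c by rewrite lerDl exprn_ge0.
(* As [t <= 1 / (1 - p / 2)], this is [1 - p <= (1 - p / 2) ^+ 2]. *)
have qt : q * t <= 1 - p / 2%:R.
  rewrite /t ler_pdivrMr //.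
  by move: thetaK; set T := theta ^+ K; rewrite /q; nra.
(* At level 0, where [w 0 = 2], the bound on [q * t] absorbs the penalty. At higher levels [w] is
   harmonic up to the excess [p * q ^+ m]. *)
have drift c : (c <= m)%N ->
    p * w m + (1 - p) * ((if c == 0%N then t else 1) * w c.-1) <= s * w c.
  move=> _; rewrite -/q /w /s; case: c => [|c] /=.
    rewrite expr0; move: qt qm0; set Q := q ^+ m; rewrite mulrA => qt qm0.
    by have := mulr_ge0 p_ge0 qm0; lra.
  rewrite exprS; have : 0 <= q ^+ c by rewrite exprn_ge0.
  move: qm0; set Q := q ^+ m; set Qc := q ^+ c => Q0 Qc0.
  have := mulr_ge0 (mulr_ge0 p_ge0 Q0) (mulr_ge0 q0 Qc0).
  have pq : p = 1 - q by rewrite /q; lra.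
  by rewrite mul1r; lra.
(* Here [s * theta <= (1 + eta) * (1 - eta) < 1]. *)
have st : s * theta < 1.
  have : p * q ^+ m <= eta by rewrite ler_wpM2l.
  by rewrite /s /theta; set x := p * _ => xe; nra.
have s0 : 0 <= s by rewrite addr_ge0 ?mulr_ge0.
apply: (@achievable_rate R _ _ _ _ _ _ (discriminator R d' m) (memory R d' m) m p
  _ _ _ _ _ _ _ t s w t1 w1 drift theta K theta0 theta1 _ K0 st s0).
- exact: discriminator_wf.
- exact: tr_rho.
- exact: tr_rho.
- exact: tr_memory.
- by move=> c [] o; apply: discriminator_ray.
- by move=> c [] o; apply: discriminator_correct.
- by move=> c []; apply: discriminator_refill.
- by rewrite mulVf // gt_eqF.
Qed.

Theorem theorem2 (R : realType) (eps delta : R) :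
  0 < eps -> 0 < delta ->
  exists (dA dB : nat) (rho0 rho1 : 'M[R[i]]_(dA * dB)),
    is_state rho0 /\ is_state rho1 /\
    P_opt rho0 rho1 = 1 /\
    P_LOCC rho0 rho1 < 2^-1 + eps /\
    1 - delta < R_m rho0 rho1.
Proof.
move=> eps0 delta0.
(* The LOCC bias [1 / (d' + 1) + p / 2] will be below [eps / 2 + eps / 4]; the minimum with 1
   ensures [p < 1]. *)
pose p := Num.min eps 1 / 2%:R.
have [p0 [p1 pe]] : 0 < p /\ p < 1 /\ p <= eps / 2%:R.
  have : 0 < Num.min eps 1 by rewrite lt_min eps0 ltr01.
  have : Num.min eps 1 <= eps by rewrite ge_min lexx.
  have : Num.min eps 1 <= 1 by rewrite ge_min lexx orbT.
  by rewrite /p; set x := Num.min _ _ => ? ? ?; split; [|split]; lra.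
have inv_small (x : R) : 0 < x -> exists n, n.+1%:R^-1 < x.
  move=> x0; exists (Num.bound x^-1); rewrite invf_plt ?posrE ?ltr0n //.
  apply: lt_trans (archi_boundP _) _; first by rewrite invr_ge0 ltW.
  by rewrite ltr_nat.
have [d' d'e] : exists n, n.+1%:R^-1 < eps / 2%:R by apply: inv_small; rewrite divr_gt0.
have [K Kd] := inv_small _ delta0.
(* The memory size [m] can be chosen last, because the LOCC bound does not involve the rank of the
   flagged pair. *)
have [m ach] := memory_rate d' p0 p1 (ltn0Sn K).
have N0 : (0 < d'.+2 ^ m)%N by rewrite expn_gt0.
exists #|side d' (d'.+2 ^ m)|, #|side d' (d'.+2 ^ m)|.
exists (rho d' (d'.+2 ^ m) p false), (rho d' (d'.+2 ^ m) p true).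
have st z : is_state (rho d' (d'.+2 ^ m) p z) by apply: rho_state; rewrite ?ltW.
split; first exact: st.
split; first exact: st.
split; first by apply: P_opt_rho; rewrite ?ltW.
split.
  apply: le_lt_trans (P_LOCC_rho _ _ _ _) _; rewrite ?ltW //.
  by move: d'e; set x := _^-1; lra.
apply: (@lt_le_trans _ _ (1 - K.+1%:R^-1)); first by rewrite ltrD2l ltrN2.
apply: ub_le_sup.
  by exists 1 => r [mA [mB [mu1 [strat [_ [_ /achievable_le1]]]]]].
exists (d'.+2 ^ m)%N, (d'.+2 ^ m)%N, (memory R d' m 0), (fun=> discriminator R d' m).
split; last first.
  by split; [move=> _; exact: discriminator_wf | exact: ach].
exact: memory_state.
Qed.
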